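(* Let $d\ge1$. There is no homogeneous Markov process $X=(X_t)_{t\ge0}$ on $\mathbb{S}_d$ with the property that, for all $\eta\in\mathbb{S}_d$, $$\mathcal{L}(X_t\,|\,X_0=\eta)\in\bigl\{\mathrm{MF}_d(\eta,\rho):\rho>0\bigr\}\quad\text{for all }t>0.$$
   Context: $\mathbb{S}_d=\{x\in\mathbb{R}^{d+1}:\|x\|=1\}$ with its Borel $\sigma$-field and uniform distribution $\mathrm{unif}(\mathbb{S}_d)$; $\lambda=(d-1)/2$; $\eta^{t}x$ is the Euclidean inner product. The von Mises--Fisher distribution $\mathrm{MF}_d(\eta,\rho)$, $\eta\in\mathbb{S}_d$, $\rho>0$, is the probability measure on $\mathbb{S}_d$ with $\mathrm{unif}(\mathbb{S}_d)$-density $x\mapsto\frac{\rho^\lambda}{2^\lambda\Gamma(\lambda+1)I_\lambda(\rho)}\exp(\rho\,\eta^{t}x)$, where $I_\lambda(x)=\sum_{n=0}^\infty\frac{1}{n!\,\Gamma(n+\lambda+1)}(x/2)^{2n+\lambda}$. A homogeneous Markov process is a time-homogeneous continuous-time Markov process with state space $(\mathbb{S}_d,\mathcal{B}(\mathbb{S}_d))$; $\mathcal{L}(X_t|X_0=\eta)$ is the distribution of $X_t$ when the process starts at $\eta$, i.e. the time-$t$ transition kernel evaluated at $\eta$. *)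

(* Defs.v *)
From HB Require Import structures.
From mathcomp Require Import all_boot all_order all_algebra.
From mathcomp Require Import all_classical all_reals all_analysis.
From mathcomp Require Import measurable_realfun.

Set Implicit Arguments.
Unset Strict Implicit.
Unset Printing Implicit Defensive.

Import Order.TTheory GRing.Theory Num.Theory.
Import numFieldNormedType.Exports.

Local Open Scope classical_set_scope.
Local Open Scope ring_scope.

Section Sphere.
Variables (R : realType) (d : nat).

Definition inner (x y : 'rV[R]_d.+1) : R := \sum_i x ord0 i * y ord0 i.

(* Not `|x|, which is the sup norm on row vectors. *)
Definition enorm (x : 'rV[R]_d.+1) : R := Num.sqrt (inner x x).

Definition sphere_set : set 'rV[R]_d.+1 := [set x | enorm x = 1].

Definition sphere : Type := set_type sphere_set.

Definition sphere_val : sphere -> 'rV[R]_d.+1 := @set_val _ sphere_set.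

HB.instance Definition _ := Choice.on sphere.
HB.instance Definition _ := Topological.copy sphere (set_type sphere_set).

Lemma enorm_delta0 : sphere_set (delta_mx ord0 ord0).
Proof.
rewrite /sphere_set /enorm /inner /= big_ord_recl !mxE /= mulr1.
by rewrite big1 ?addr0 ?sqrtr1 // => i _; rewrite !mxE /= mulr0.
Qed.

HB.instance Definition _ := isPointed.Build sphere (SigSub (mem_set enorm_delta0)).

(* Borel sigma-algebra of the subspace topology inherited from R^(d+1). *)
HB.instance Definition _ :=
  Measurable.copy sphere (g_sigma_algebraType (@open sphere)).

Lemma inner_orthogonal (O : 'M[R]_d.+1) (x y : 'rV[R]_d.+1) :
  O *m O^T = 1%:M -> inner (x *m O) (y *m O) = inner x y.
Proof.
move=> OO.
have E u v : inner u v = (u *m v^T) ord0 ord0.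
  by rewrite mxE; apply: eq_bigr => i _; rewrite mxE.
by rewrite !E trmx_mul mulmxA -(mulmxA x) OO mulmx1.
Qed.

Lemma sphere_orthogonal (O : 'M[R]_d.+1) (x : sphere) :
  O *m O^T = 1%:M -> sphere_set (sphere_val x *m O).
Proof.
move=> OO; rewrite /sphere_set /enorm /= inner_orthogonal //.
exact: set_valP x.
Qed.

(* Row vectors: the orthogonal matrix O acts on the right. *)
Definition orthogonal_act (O : 'M[R]_d.+1) (OO : O *m O^T = 1%:M)
  (x : sphere) : sphere := SigSub (mem_set (sphere_orthogonal x OO)).

(* The uniform distribution on the sphere is the (unique) Borel probability
   measure that is invariant under the orthogonal group. *)
Definition is_uniform (sigma : probability sphere R) : Prop :=
  forall (O : 'M[R]_d.+1) (OO : O *m O^T = 1%:M) (A : set sphere),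
    measurable A -> sigma (orthogonal_act OO @^-1` A) = sigma A.

End Sphere.

Section VonMisesFisher.
Variable R : realType.

Definition Gamma (a : R) : R :=
  Rintegral (@lebesgue_measure R) `]0, +oo[
    (fun x => x `^ (a - 1) * expR (- x)).

Definition besselI (l x : R) : R :=
  limn (series (fun n : nat =>
    (n`!%:R * Gamma (n%:R + l + 1))^-1 * (x / 2) `^ (2 * n%:R + l))).

Variable d : nat.

Definition lambda : R := (d%:R - 1) / 2.

Definition MF_density (eta : sphere R d) (rho : R) (x : sphere R d) : R :=
  rho `^ lambda / (2 `^ lambda * Gamma (lambda + 1) * besselI lambda rho)
  * expR (rho * inner (sphere_val eta) (sphere_val x)).

Definition MF (sigma : probability (sphere R d) R) (eta : sphere R d) (rho : R)
    (A : set (sphere R d)) : \bar R :=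
  (\int[sigma]_(x in A) (MF_density eta rho x)%:E)%E.

End VonMisesFisher.

Section Markov.
Context {R : realType} {dO dS : measure_display}.
Variables (Omega : measurableType dO) (S : measurableType dS).

Definition natural_filtration (X : R -> Omega -> S) (s : R) :
    set (set Omega) :=
  <<s \bigcup_(u in `[0, s]) preimage_set_system setT (X u) measurable >>.

(* [mp_law x] is the probability on Omega under which the process starts at x.
   Only the values [mp_path t] with 0 <= t are meaningful.  The Markov property
   is relative to the natural filtration, the conditional probability being
   written through its defining integral identity; as in the usual definition
   of a Markov family, no regularity of the paths is required. *)
Record homogeneous_markov_process : Type := HomogeneousMarkovProcess {
  mp_law : S -> probability Omega R ;
  mp_path : R -> Omega -> S ;
  mp_measurable : forall t : R, 0 <= t ->
    measurable_fun [set: Omega] (mp_path t) ;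
  mp_kernel : forall (t : R) (B : set S), 0 <= t -> measurable B ->
    measurable_fun [set: S]
      (fun x => mp_law x (mp_path t @^-1` B)) ;
  mp_start : forall x (B : set S), measurable B ->
    mp_law x (mp_path 0 @^-1` B) = \d_x B ;
  mp_markov : forall x (s t : R) (F : set Omega) (B : set S),
    0 <= s -> 0 <= t -> natural_filtration mp_path s F -> measurable B ->
    mp_law x (F `&` mp_path (s + t) @^-1` B) =
    (\int[mp_law x]_(w in F)
       mp_law (mp_path s w) (mp_path t @^-1` B))%E
}.

(* The law of X_t given X_0 = x, i.e. the time-t transition kernel at x. *)
Definition transition (X : homogeneous_markov_process) (t : R) (x : S) :
    set S -> \bar R :=
  pushforward (mp_law X x) (mp_path X t).

End Markov.
Arguments homogeneous_markov_process R {dO dS} Omega S.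

(* Main.v *)
(* Suppose such a process exists and let [r k x] be the concentration of the law of
   X_(k+1) started at x; the total mass being 1, the normalising constant is the
   inverse of the integral of exp (r <x, y>) and Bessel functions play no role.
   Comparing the laws started at x and at -x, a Doeblin-type contraction in total
   variation gives [r k x] -> 0.  The operator P at time 1 acts on linear functions
   u by (P u)(y) = alpha(y) <u, y>, where alpha is the mean resultant length, and on
   the harmonic <u, .> <v, .> (u orthogonal to v) by multiplication with beta(y).
   The Chapman-Kolmogorov equation tested on u orthogonal to x says that
   alpha(y) <u, y> exp (s <x, y>) has integral 0 for s = r k x, so the analytic
   function of s on the left vanishes identically.  Hence the function alpha, and
   similarly beta, has the same moments <x, y>^k as a constant, which makes the
   first and the second mean resultant lengths a and b of X_k exactly geometric
   in k, and so is b / a^2.  As the concentration tends to 0 this quotient tends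
   to a limit other than 0, so it is constant along the sequence; this contradicts
   its expansion b / a^2 = l (1 + l' s^2 + ...) with l' <> 0. *)
Require Import Defs.
From HB Require Import structures.
From mathcomp Require Import all_boot all_order all_algebra.
From mathcomp Require Import all_classical all_reals all_analysis.
From mathcomp Require Import measurable_realfun.
From mathcomp Require Import ring lra.

Set Implicit Arguments.
Unset Strict Implicit.
Unset Printing Implicit Defensive.

Import Order.TTheory GRing.Theory Num.Theory.
Import numFieldNormedType.Exports.

Local Open Scope classical_set_scope.
Local Open Scope ring_scope.

(** * Integration of bounded measurable functions *)

Section BoundedMeasurable.
Context {R : realType} {dT : measure_display} {T : measurableType dT}.
Implicit Types f g : T -> R.

Definition bmf f := measurable_fun [set: T] f /\ exists M, forall x, `|f x| <= M.

Lemma bmf_cst c : bmf (fun=> c).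
Proof. by split; [exact: measurable_cst | exists `|c|]. Qed.

Lemma bmfD f g : bmf f -> bmf g -> bmf (fun x => f x + g x).
Proof.
move=> [mf [M fM]] [mg [L gL]]; split; first exact: measurable_funD.
by exists (M + L) => x; rewrite (le_trans (ler_normD _ _))// lerD.
Qed.

Lemma bmfN f : bmf f -> bmf (fun x => - f x).
Proof.
move=> [mf [M fM]]; split; first exact: measurableT_comp.
by exists M => x; rewrite normrN.
Qed.

Lemma bmfB f g : bmf f -> bmf g -> bmf (fun x => f x - g x).
Proof. by move=> bf bg; apply: bmfD => //; exact: bmfN. Qed.

Lemma bmfM f g : bmf f -> bmf g -> bmf (fun x => f x * g x).
Proof.
move=> [mf [M fM]] [mg [L gL]]; split; first exact: measurable_funM.
by exists (M * L) => x; rewrite normrM ler_pM.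
Qed.

Lemma bmfX f n : bmf f -> bmf (fun x => f x ^+ n).
Proof.
move=> bf; elim: n => [|n IH]; first exact: bmf_cst.
have -> : (fun x => f x ^+ n.+1) = fun x => f x * f x ^+ n.
  by apply/funext => x; rewrite exprS.
exact: bmfM.
Qed.

Lemma bmf_exp f : bmf f -> bmf (fun x => expR (f x)).
Proof.
move=> [mf [M fM]]; split; first exact: measurableT_comp.
exists (expR M) => x; rewrite ger0_norm ?expR_ge0// ler_expR.
exact: le_trans (ler_norm _) (fM x).
Qed.

Lemma bmf_sum (J : Type) (s : seq J) (P : pred J) (F : J -> T -> R) :
  (forall j, bmf (F j)) -> bmf (fun x => \sum_(j <- s | P j) F j x).
Proof.
move=> bF; elim: s => [|j s IH].
  by under eq_fun do rewrite big_nil; exact: bmf_cst.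
under eq_fun do rewrite big_cons.
by case: (P j) => //; exact: bmfD.
Qed.

Lemma bmf_indic A : measurable A -> bmf (\1_A : T -> R).
Proof.
move=> mA; split; first exact: measurable_indic.
by exists 1 => x; rewrite indicE; case: (_ \in _); rewrite ?normr1 ?normr0.
Qed.

(** The sum counts the integers from 1 to [m] that are at most [t], so it is the integer part of
    [t]. *)
Lemma count_thresholds (t : R) m : 0 <= t <= m%:R ->
  `|\sum_(i < m) ((i.+1%:R <= t)%R%:R : R) - t| <= 1.
Proof.
elim: m => [|m IH] /andP[t0 tm].
  by rewrite big_ord0 sub0r normrN ger0_norm// (le_trans tm).
rewrite big_ord_recr/=; have [tm'|mt] := leP t m%:R.
  have -> : (m.+1%:R <= t) = false.
    by apply/negbTE; rewrite -ltNge (le_lt_trans tm')// ltr_nat.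
  by rewrite addr0; apply: IH; rewrite t0.
rewrite (eq_bigr (fun=> 1)); last first.
  move=> i _; suff -> : (i.+1%:R <= t) by [].
  by rewrite (le_trans _ (ltW mt))// ler_nat.
rewrite sumr_const card_ord.
have : m.+1%:R = m%:R + 1 :> R by rewrite -natr1.
by case: (leP m.+1%:R t) => h e /=; rewrite ler_norml; apply/andP; split; lra.
Qed.

(** A function with values in [0,1] is within 1/(n+1) of the average of the indicators of its
    superlevel sets {f >= (i+1)/(n+1)}, by [count_thresholds]; an affine rescaling reduces any
    bounded function to this case. *)
Lemma bmf_ind (Pr : (T -> R) -> Prop) :
  (forall A, measurable A -> Pr \1_A) ->
  (forall a f g, bmf f -> bmf g -> Pr f -> Pr g -> Pr (fun x => a * f x + g x)) ->
  (forall (f_ : nat -> T -> R) f, (forall n, bmf (f_ n)) -> bmf f ->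
     (forall n, Pr (f_ n)) -> (forall n x, `|f_ n x - f x| <= n.+1%:R^-1) -> Pr f) ->
  forall f, bmf f -> Pr f.
Proof.
move=> Pind Plin Plim.
have P0 : Pr (fun=> 0).
  rewrite (_ : (fun=> 0) = \1_set0); last by apply/funext => x; rewrite indic0.
  exact: Pind.
have bsc a f g : bmf f -> bmf g -> bmf (fun x => a * f x + g x).
  by move=> bf bg; apply: bmfD => //; apply: bmfM => //; exact: bmf_cst.
have Psum (A : nat -> set T) (a : R) m : (forall i, measurable (A i)) ->
    bmf (fun x => \sum_(i < m) a * \1_(A i) x) /\
    Pr (fun x => \sum_(i < m) a * \1_(A i) x).
  move=> mA; elim: m => [|m [bm IH]].
    under eq_fun do rewrite big_ord0.
    by split => //; exact: bmf_cst.
  rewrite (_ : (fun x => _) = (fun x => a * \1_(A m) x +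
      \sum_(i < m) a * \1_(A i) x)); last first.
    by apply/funext => x; rewrite big_ord_recr/= addrC.
  split; first by apply: bsc => //; exact: bmf_indic.
  by apply: Plin => //; [exact: bmf_indic | exact: Pind].
have P01 f : bmf f -> (forall x, 0 <= f x <= 1) -> Pr f.
  move=> bf f01.
  pose A n i := [set x | i.+1%:R / n.+1%:R <= f x].
  have mA n i : measurable (A n i).
    rewrite (_ : A n i = setT `&` f @^-1` `[i.+1%:R / n.+1%:R, +oo[).
      by apply: bf.1 => //.
    by apply/seteqP; split => x /=; rewrite /A /= in_itv/= andbT // => -[].
  apply: (Plim (fun n x => \sum_(i < n.+1) n.+1%:R^-1 * \1_(A n i) x)) => //.
  - by move=> n; exact: (Psum _ _ _ _).1.
  - by move=> n; exact: (Psum _ _ _ _).2.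
  move=> n x; rewrite -mulr_sumr.
  have n0 : 0 < n.+1%:R :> R by rewrite ltr0n.
  have -> : n.+1%:R^-1 * (\sum_(i < n.+1) \1_(A n i) x) - f x =
    n.+1%:R^-1 * (\sum_(i < n.+1) (i.+1%:R <= f x * n.+1%:R)%R%:R - f x * n.+1%:R).
    rewrite mulrBr; congr (_ - _); last by rewrite mulrCA mulVf ?mulr1// gt_eqF.
    congr (_ * _); apply: eq_bigr => i _; rewrite indicE; congr ((nat_of_bool _)%:R).
    rewrite -ler_pdivrMr//.
    by apply/idP/idP; rewrite inE.
  rewrite normrM ger0_norm ?invr_ge0 ?ler0n//.
  rewrite -[leRHS]mulr1 ler_wpM2l ?invr_ge0 ?ler0n//; apply: count_thresholds.
  have /andP[f0 f1] := f01 x.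
  by rewrite mulr_ge0 ?ler0n//= ler_piMl ?ler0n.
move=> f bf; have [mf [M fM]] := bf.
have [M0|M0] := ltP 0 M; last first.
  rewrite (_ : f = fun=> 0)//; apply/funext => x; apply/eqP.
  by rewrite -normr_le0 (le_trans (fM x)).
pose g x := (f x + M) / (2 * M).
have bg : bmf g by apply: bmfM; [apply: bmfD => //; exact: bmf_cst|exact: bmf_cst].
have M20 : 0 < 2 * M by lra.
have Pg : Pr g.
  apply: P01 => // x; have := fM x; rewrite ler_norml => /andP[? ?].
  by rewrite /g divr_ge0/= ?ler_pdivrMr//; lra.
have P1 : Pr (fun=> 1).
  rewrite (_ : (fun=> 1) = \1_setT); last by apply/funext => x; rewrite indicT.
  exact: Pind.
rewrite (_ : f = fun x => - M * (fun=> 1) x + ((2 * M) * g x + (fun=> 0) x)).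
  apply: (Plin (- M)) => //; first exact: bmf_cst.
    by apply: bsc => //; exact: bmf_cst.
  by apply: (Plin (2 * M)) => //; exact: bmf_cst.
apply/funext => x /=; rewrite /g.
by rewrite mulrCA divff ?gt_eqF//; lra.
Qed.

Lemma le_harmonic_eq0 (x C : R) : (forall n, `|x| <= C * n.+1%:R^-1) -> x = 0.
Proof.
move=> xC; apply/eqP; rewrite -normr_eq0; apply/eqP.
have C0 : 0 <= C by have := le_trans (normr_ge0 _) (xC 0); rewrite invr1 mulr1.
apply/eqP; case: (ltgtP `|x| 0) => // [|x0]; first by rewrite ltNge normr_ge0.
have := xC (Num.truncn (C / `|x|)).
have n0 m : 0 < m.+1%:R :> R by rewrite ltr0n.
rewrite ler_pdivlMr// leNgt => /negP; case.
by rewrite mulrC -ltr_pdivrMr// truncnS_gt.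
Qed.

Section Integral.
Variable mu : probability T R.
Local Notation I f := (\int[mu]_x f x).

Lemma bmf_integrable f : bmf f -> mu.-integrable setT (EFin \o f).
Proof.
move=> [mf [M fM]]; apply: measurable_bounded_integrable => //.
  by apply: (@le_lt_trans _ _ 1%E); rewrite ?probability_le1 ?ltry.
exists M; split; first exact: num_real.
by move=> y My x _; exact: le_trans (fM x) (ltW My).
Qed.

Lemma eq_I f g : f =1 g -> I f = I g.
Proof. by move=> fg; apply: eq_Rintegral => x _; exact: fg. Qed.

Lemma I_cst c : I (fun=> c) = c.
Proof.
rewrite Rintegral_cst//.
by rewrite [X in fine X]probability_setT mulr1.
Qed.

Lemma ID f g : bmf f -> bmf g -> I (fun x => f x + g x) = I f + I g.
Proof. by move=> bf bg; rewrite RintegralD//; exact: bmf_integrable. Qed.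

Lemma IB f g : bmf f -> bmf g -> I (fun x => f x - g x) = I f - I g.
Proof. by move=> bf bg; rewrite RintegralB//; exact: bmf_integrable. Qed.

Lemma IZ c f : bmf f -> I (fun x => c * f x) = c * I f.
Proof. by move=> bf; rewrite RintegralZl//; exact: bmf_integrable. Qed.

Lemma IZr c f : bmf f -> I (fun x => f x * c) = I f * c.
Proof. by move=> bf; rewrite RintegralZr//; exact: bmf_integrable. Qed.

Lemma I_sum (J : Type) (s : seq J) (P : pred J) (F : J -> T -> R) :
  (forall j, bmf (F j)) ->
  I (fun x => \sum_(j <- s | P j) F j x) = \sum_(j <- s | P j) I (F j).
Proof.
move=> bF; elim: s => [|j s IH].
  by under eq_I do rewrite big_nil; rewrite I_cst big_nil.
under eq_I do rewrite big_cons.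
rewrite big_cons; case: (P j) => //.
by rewrite ID ?IH//; exact: bmf_sum.
Qed.

Lemma le_I f g : bmf f -> bmf g -> (forall x, f x <= g x) -> I f <= I g.
Proof. by move=> bf bg fg; apply: le_Rintegral => //; exact: bmf_integrable. Qed.

Lemma I_ge0 f : (forall x, 0 <= f x) -> 0 <= I f.
Proof. by move=> f0; apply: Rintegral_ge0 => x _. Qed.

Lemma abs_I f M : bmf f -> (forall x, `|f x| <= M) -> `|I f| <= M.
Proof.
move=> bf fM; rewrite ler_norml -(I_cst (- M)) -{2}(I_cst M).
by apply/andP; split; apply: le_I => //; try exact: bmf_cst;
  move=> x; have := fM x; rewrite ler_norml => /andP[].
Qed.

Lemma I_indic A : measurable A -> I \1_A = fine (mu A).
Proof.
by move=> mA; rewrite /Rintegral integral_indic// setIT.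
Qed.

End Integral.

(** The second clause is norm at most 1 for the supremum norm. Expectations under the process, under
    a von Mises-Fisher law and under compositions of kernels are all of this kind, so they can be
    compared on indicators. *)
Definition bdd_functional (L : (T -> R) -> R) :=
  (forall a f g, bmf f -> bmf g -> L (fun x => a * f x + g x) = a * L f + L g) /\
  (forall f M, bmf f -> (forall x, `|f x| <= M) -> `|L f| <= M).

Lemma bdd_functionalB (L : (T -> R) -> R) f g : bdd_functional L ->
  bmf f -> bmf g -> L (fun x => f x - g x) = L f - L g.
Proof.
move=> [lin _] bf bg; rewrite [RHS]addrC -mulN1r -lin//.
by congr L; apply/funext => x; rewrite mulN1r addrC.
Qed.

(** Agreement on indicators passes to linear combinations by linearity and to uniform limits by the
    norm bound, which is what [bmf_ind] asks for. *)
Lemma bdd_functional_ext (L1 L2 : (T -> R) -> R) :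
  bdd_functional L1 -> bdd_functional L2 ->
  (forall A, measurable A -> L1 \1_A = L2 \1_A) ->
  forall f, bmf f -> L1 f = L2 f.
Proof.
move=> F1 F2 E; apply: bmf_ind => //.
  by move=> a f g bf bg f12 g12; rewrite F1.1// F2.1// f12 g12.
move=> f_ f bf_ bf f12 ff; apply/eqP; rewrite -subr_eq0; apply/eqP.
apply: (@le_harmonic_eq0 _ 2) => n.
have -> : L1 f - L2 f = L2 (fun x => f_ n x - f x) - L1 (fun x => f_ n x - f x).
  by rewrite !bdd_functionalB// f12; ring.
rewrite mulrDl mul1r; apply: (le_trans (ler_normB _ _)).
by apply: lerD; [apply: F2.2|apply: F1.2] => //; exact: bmfB.
Qed.

End BoundedMeasurable.

Lemma I_functional (R : realType) d1 d2 (T1 : measurableType d1)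
    (T2 : measurableType d2) (mu : probability T1 R) (phi : T1 -> T2) :
  measurable_fun setT phi ->
  bdd_functional (fun f : T2 -> R => \int[mu]_x f (phi x)).
Proof.
move=> mphi; have bc (f : T2 -> R) : bmf f -> bmf (f \o phi).
  move=> [mf [M fM]]; split; first exact: measurableT_comp.
  by exists M => x; exact: fM.
split=> [a f g bf bg|f M bf fM]; last first.
  by apply: abs_I => [|x]; [exact: (bc f) | exact: fM].
have bf' := bc _ bf; have bg' := bc _ bg.
by rewrite ID ?IZ//; apply: (@bmfM _ _ _ (fun=> a)) => //; exact: bmf_cst.
Qed.

(** * The sphere: coordinates, Borel structure, orthogonal maps *)

Section SphereMeasurability.
Variables (R : realType) (d : nat).
Local Notation S := (sphere R d).

Definition co (y : S) (i : 'I_d.+1) : R := sphere_val y ord0 i.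
Definition dot (u : 'rV[R]_d.+1) (y : S) : R := inner u (sphere_val y).

Lemma sphere_val_continuous : continuous (@sphere_val R d).
Proof. exact: initial_continuous. Qed.

Lemma co_continuous i : continuous (fun y : S => co y i).
Proof.
move=> y; apply: (@continuous_comp _ _ _ (@sphere_val R d)
  (fun M : 'rV[R]_d.+1 => M ord0 i)); first exact: sphere_val_continuous.
exact: coord_continuous.
Qed.

Lemma continuous_sphere_measurable (f : S -> R) : continuous f ->
  measurable_fun [set: S] f.
Proof.
move=> /continuousP cf; apply: (measurability _ (RGenOpens.measurableE R)).
move=> _ [_ [a [b ->] <-]]; rewrite setTI.
by apply: sub_sigma_algebra; exact/cf/interval_open.
Qed.

Lemma sphere_sqr (y : S) : inner (sphere_val y) (sphere_val y) = 1.
Proof.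
have : enorm (sphere_val y) = 1 by exact: (set_valP y).
rewrite /enorm => h; rewrite -[LHS]sqr_sqrtr ?h ?expr1n//.
by apply: sumr_ge0 => i _; rewrite -expr2 sqr_ge0.
Qed.

Lemma co_sqr_sum (y : S) : \sum_i co y i ^+ 2 = 1.
Proof. by rewrite -(sphere_sqr y); apply: eq_bigr => i _; rewrite expr2. Qed.

Lemma co_le1 (y : S) i : `|co y i| <= 1.
Proof.
rewrite -(@ler_pXn2r _ 2)// ?nnegrE// expr1n real_normK ?num_real//.
rewrite -(co_sqr_sum y) (bigD1 i)//= lerDl.
by apply: sumr_ge0 => j _; exact: sqr_ge0.
Qed.

Lemma bmf_co i : bmf (co ^~ i).
Proof.
split; last by exists 1 => y; exact: co_le1.
apply: continuous_sphere_measurable; exact: co_continuous.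
Qed.

Lemma dotE u y : dot u y = \sum_i u ord0 i * co y i.
Proof. by []. Qed.

Lemma bmf_dot u : bmf (dot u).
Proof.
rewrite (_ : dot u = fun y => \sum_i u ord0 i * co y i)//.
by apply: bmf_sum => i; apply: bmfM; [exact: bmf_cst | exact: bmf_co].
Qed.

Lemma mem_sphere (u : 'rV[R]_d.+1) : inner u u = 1 -> u \in @sphere_set R d.
Proof. by move=> u1; rewrite inE /sphere_set /enorm /= u1 sqrtr1. Qed.

Definition mks u (u1 : inner u u = 1) : S := SigSub (mem_sphere u1).

Lemma mksE u (u1 : inner u u = 1) : sphere_val (mks u1) = u.
Proof. by []. Qed.

Variables (O : 'M[R]_d.+1) (OO : O *m O^T = 1%:M).

Lemma act_continuous : continuous (orthogonal_act OO).
Proof.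
have cv : continuous (fun M : 'rV[R]_d.+1 => M *m O).
  (* Neighbourhoods of a matrix are generated by products of neighbourhoods of its entries, so
     continuity is checked entry by entry and the finitely many conditions are intersected. *)
  move=> M A [P nP PA].
  have nP' i j : nbhs M [set L : 'rV[R]_d.+1 | P i j ((L *m O) i j)].
    have : continuous (fun L : 'rV[R]_d.+1 => (L *m O) i j).
      under eq_fun do rewrite mxE.
      apply: continuous_big => [|k _]; first exact: add_continuous.
      move=> L; apply: (@continuousM _ _ (fun L : 'rV[R]_d.+1 => L i k)).
        exact: coord_continuous.
      exact: cst_continuous.
    by apply; exact: nP.
  have : nbhs M [set L : 'rV[R]_d.+1 | forall i j, P i j ((L *m O) i j)].
    apply: (@filter_forall _ _ (fun (i : 'I_1) (L : 'rV[R]_d.+1) =>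
      forall j, P i j ((L *m O) i j)) (nbhs M) (nbhs_filter M)) => i.
    by apply: (@filter_forall _ _ (fun j (L : 'rV[R]_d.+1) =>
      P i j ((L *m O) i j)) (nbhs M) (nbhs_filter M)) => j; exact: nP'.
  apply: (@filterS _ (nbhs M) (nbhs_filter M)) => L /= PL; exact: PA.
have {}cv : continuous (fun y : S => sphere_val y *m O).
  move=> y; apply: (@continuous_comp _ _ _ (@sphere_val R d)
    (fun M : 'rV[R]_d.+1 => M *m O)); last exact: cv.
  exact: sphere_val_continuous.
apply/continuousP => A [V oV <-].
rewrite (_ : _ @^-1` _ = (fun y : S => sphere_val y *m O) @^-1` V)//.
by move/continuousP: cv; exact.
Qed.

Lemma act_measurable : measurable_fun [set: S] (orthogonal_act OO).
Proof.
apply: (@measurability _ _ _ _ _ _ (@open S)) => //.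
move=> _ [A oA <-]; rewrite setTI; apply: sub_sigma_algebra.
by move/continuousP: act_continuous; exact.
Qed.

Lemma sphere_val_act y : sphere_val (orthogonal_act OO y) = sphere_val y *m O.
Proof. by []. Qed.

Lemma innerE (u v : 'rV[R]_d.+1) : inner u v = (u *m v^T) ord0 ord0.
Proof. by rewrite mxE; apply: eq_bigr => i _; rewrite mxE. Qed.

Lemma dot_act u y : dot u (orthogonal_act OO y) = dot (u *m O^T) y.
Proof. by rewrite /dot sphere_val_act !innerE trmx_mul mulmxA. Qed.

Variable sigma : probability S R.
Hypothesis hsigma : is_uniform sigma.

Lemma I_act (f : S -> R) : bmf f ->
  \int[sigma]_y f (orthogonal_act OO y) = \int[sigma]_y f y.
Proof.
move: f; apply: (bdd_functional_ext
  (L1 := fun f => \int[sigma]_y f (orthogonal_act OO y))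
  (L2 := fun f => \int[sigma]_y f y)).
- by apply: I_functional; exact: act_measurable.
- by apply: (I_functional _ (phi := id)); exact: measurable_id.
move=> A mA; have mA' : measurable (orthogonal_act OO @^-1` A).
  by rewrite -[X in measurable X]setTI; exact: act_measurable.
rewrite [LHS](_ : _ = \int[sigma]_y \1_(orthogonal_act OO @^-1` A) y)//.
by rewrite !I_indic//; congr fine; exact: hsigma.
Qed.

End SphereMeasurability.

Ltac solve_bmf := by do ![assumption | exact: bmf_cst | exact: bmf_dot |
  exact: bmf_co | apply: bmf_exp | apply: bmfX | apply: bmfB | apply: bmfN |
  apply: bmfD | apply: bmfM].

(** * Reflections and the isotropy of exponential integrals *)

Section Isotropy.
Variables (R : realType) (d : nat).
Local Notation S := (sphere R d).
Implicit Types (u v p q : 'rV[R]_d.+1) (y : S).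

Lemma innerC u v : inner u v = inner v u.
Proof. by apply: eq_bigr => i _; rewrite mulrC. Qed.

Lemma innerDl p u v : inner (p + u) v = inner p v + inner u v.
Proof. by rewrite /inner -big_split; apply: eq_bigr => i _; rewrite mxE mulrDl. Qed.

Lemma innerZl a u v : inner (a *: u) v = a * inner u v.
Proof. by rewrite /inner mulr_sumr; apply: eq_bigr => i _; rewrite mxE mulrA. Qed.

Lemma innerNl u v : inner (- u) v = - inner u v.
Proof. by rewrite -scaleN1r innerZl mulN1r. Qed.

Lemma innerBl p u v : inner (p - u) v = inner p v - inner u v.
Proof. by rewrite innerDl innerNl. Qed.

Lemma innerDr p u v : inner v (p + u) = inner v p + inner v u.
Proof. by rewrite !(innerC v) innerDl. Qed.

Lemma innerZr a u v : inner v (a *: u) = a * inner v u.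
Proof. by rewrite !(innerC v) innerZl. Qed.

Lemma innerNr u v : inner v (- u) = - inner v u.
Proof. by rewrite !(innerC v) innerNl. Qed.

Lemma innerBr p u v : inner v (p - u) = inner v p - inner v u.
Proof. by rewrite !(innerC v) innerBl. Qed.

Lemma inner0l u : inner 0 u = 0.
Proof. by rewrite -(scale0r 0) innerZl mul0r. Qed.

Lemma inner_eq0 u : (inner u u == 0) = (u == 0).
Proof.
apply/idP/eqP => [|->]; last by rewrite inner0l.
rewrite psumr_eq0 => [/allP u0|i _]; last by rewrite -expr2 sqr_ge0.
apply/rowP => i; rewrite mxE; have := u0 i (mem_index_enum _).
by rewrite -expr2 sqrf_eq0 => /eqP.
Qed.

Lemma inner_ge0 u : 0 <= inner u u.
Proof. by apply: sumr_ge0 => i _; rewrite -expr2 sqr_ge0. Qed.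

Lemma inner_delta i v : inner (delta_mx ord0 i) v = v ord0 i.
Proof.
rewrite /inner (bigD1 i)//= big1 ?addr0 ?mxE ?eqxx ?mul1r// => j ji.
by rewrite mxE eqxx (negbTE ji) mul0r.
Qed.

Lemma dotD u v y : dot (u + v) y = dot u y + dot v y.
Proof. exact: innerDl. Qed.

Lemma dotZ a u y : dot (a *: u) y = a * dot u y.
Proof. exact: innerZl. Qed.

Lemma dotB u v y : dot (u - v) y = dot u y - dot v y.
Proof. exact: innerBl. Qed.

Lemma dot_delta i y : dot (delta_mx ord0 i) y = co y i.
Proof. exact: inner_delta. Qed.

Lemma dot_sqr_le u y : dot u y ^+ 2 <= inner u u.
Proof.
have := inner_ge0 (u - dot u y *: sphere_val y).
rewrite !(innerBl, innerBr, innerZl, innerZr) sphere_sqr /dot.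
by rewrite (innerC (sphere_val y)); set t := inner _ _; nra.
Qed.

Lemma dot_le1 (x y : S) : `|dot (sphere_val x) y| <= 1.
Proof.
rewrite -(@ler_pXn2r _ 2)// ?nnegrE// expr1n real_normK ?num_real//.
by rewrite (le_trans (dot_sqr_le _ _))// sphere_sqr.
Qed.

(* The reflection y |-> y - 2 <u, y> u / <u, u>; for u = 0 it is the identity. *)
Definition householder u : 'M[R]_d.+1 :=
  1%:M - (2 / inner u u) *: (u^T *m u).

Lemma householderT u : (householder u)^T = householder u.
Proof.
by rewrite /householder linearB/= tr_scalar_mx linearZ/= trmx_mul trmxK.
Qed.

Lemma householder_mul v u : v *m householder u = v - (2 * inner v u / inner u u) *: u.
Proof.
rewrite mulmxBr mulmx1 -scalemxAr mulmxA (mx11_scalar (v *m u^T)) -innerE.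
by rewrite mul_scalar_mx scalerA; congr (_ - _ *: _); ring.
Qed.

Lemma householder_orth u : householder u *m (householder u)^T = 1%:M.
Proof.
rewrite householderT; apply/row_matrixP => i; rewrite !rowE mulmxA mulmx1.
rewrite !householder_mul innerBl innerZl.
have [->|u0] := eqVneq u 0; first by rewrite !scaler0 !subr0.
have uu0 : inner u u != 0 by rewrite inner_eq0.
rewrite -addrA -opprD -scalerDl [X in X *: _](_ : _ = 0) ?scale0r ?subr0//.
by field.
Qed.

Definition refl u := orthogonal_act (householder_orth u).

Lemma dot_refl v u y :
  dot v (refl u y) = dot v y - 2 * inner v u / inner u u * dot u y.
Proof. by rewrite /refl dot_act householderT householder_mul dotB dotZ. Qed.

Lemma dot_refl_self u y : dot u (refl u y) = - dot u y.
Proof.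
rewrite dot_refl; have [->|u0] := eqVneq u 0.
  by rewrite /dot inner0l mulr0 subr0 oppr0.
by rewrite -inner_eq0 in u0; field.
Qed.

Lemma dot_refl_orth v u y : inner v u = 0 -> dot v (refl u y) = dot v y.
Proof. by move=> vu; rewrite dot_refl vu mulr0 !mul0r subr0. Qed.

(** The reflection along [p - q] exchanges vectors of equal length. If [p = q] it is the identity,
    because the inverse of 0 is 0. *)
Lemma dot_refl_swap p q y : inner p p = inner q q -> dot p (refl (p - q) y) = dot q y.
Proof.
move=> pq; rewrite dot_refl; have [/eqP|u0] := eqVneq (p - q) 0.
  by rewrite subr_eq0 => /eqP ->; rewrite subrr inner0l invr0 mulr0 mul0r subr0.
have uu : inner (p - q) (p - q) = 2 * inner p (p - q).
  by rewrite !(innerBl, innerBr) -pq (innerC q p); ring.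
move: (u0); rewrite -inner_eq0 uu => h.
by rewrite divff// mul1r dotB; ring.
Qed.

Variable sigma : probability S R.
Hypothesis hsigma : is_uniform sigma.
Local Notation I f := (\int[sigma]_y f y).

Lemma I_refl u (f : S -> R) : bmf f -> I (f \o refl u) = I f.
Proof. exact: I_act. Qed.

(** The reflection along [u] preserves the measure and changes the sign of the integrand. *)
Lemma I_odd u (g : S -> R) : bmf g -> (forall y, g (refl u y) = g y) ->
  I (fun y => dot u y * g y) = 0.
Proof.
move=> bg gu; have b : bmf (fun y => dot u y * g y).
  by apply: bmfM => //; exact: bmf_dot.
have := I_refl u b; rewrite (@eq_I _ _ _ _ _ (fun y => -1 * (dot u y * g y))).
  by rewrite IZ// => h; lra.
by move=> y /=; rewrite gu dot_refl_self; ring.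
Qed.

Lemma I_dot p q (phi : R -> R) : inner p p = inner q q ->
  bmf (phi \o dot p) -> I (phi \o dot p) = I (phi \o dot q).
Proof.
move=> pq bp; rewrite -(I_refl (p - q) bp).
by apply: eq_I => y /=; rewrite dot_refl_swap.
Qed.

(** The [j]-th derivative at [r] of the integral of exp (r y_0); for [j = 0] this is the normalising
    constant. By [xpow_dot] any point [x] of the sphere may replace the first basis vector. *)
Definition xpow (j : nat) (r : R) := I (fun y => co y ord0 ^+ j * expR (r * co y ord0)).

Lemma bmf_xpow p j r : bmf (fun y => dot p y ^+ j * expR (r * dot p y)).
Proof.
apply: bmfM; first by apply: bmfX; exact: bmf_dot.
by apply/bmf_exp/bmfM; [exact: bmf_cst | exact: bmf_dot].
Qed.

Lemma xpow_dot (x : S) j r :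
  I (fun y => dot (sphere_val x) y ^+ j * expR (r * dot (sphere_val x) y)) = xpow j r.
Proof.
rewrite (@I_dot _ (delta_mx ord0 ord0) (fun t => t ^+ j * expR (r * t))).
- by apply: eq_I => y /=; rewrite dot_delta.
- by rewrite inner_delta mxE !eqxx sphere_sqr.
- exact: bmf_xpow.
Qed.

(** In u = <u,x> x + u' the part u' orthogonal to [x] contributes 0 by [I_odd], as the reflection
    along u' fixes <x,y>. *)
Lemma isotropy1 (x : S) u r :
  I (fun y => dot u y * expR (r * dot (sphere_val x) y)) =
  inner u (sphere_val x) * xpow 1 r.
Proof.
have bE : bmf (fun y => expR (r * dot (sphere_val x) y)).
  by apply/bmf_exp/bmfM; [exact: bmf_cst | exact: bmf_dot].
pose c := inner u (sphere_val x); pose u' := u - c *: sphere_val x.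
have u'x : inner (sphere_val x) u' = 0.
  by rewrite innerC /u' innerBl innerZl sphere_sqr mulr1 subrr.
rewrite (@eq_I _ _ _ _ _ (fun y => c * (dot (sphere_val x) y ^+ 1 *
   expR (r * dot (sphere_val x) y)) + dot u' y * expR (r * dot (sphere_val x) y))).
  have b1 := bmf_xpow (sphere_val x) 1 r; have b2 := bmfM (bmf_dot u') bE.
  rewrite (ID sigma (bmfM (bmf_cst c) b1) b2) (IZ sigma c b1) xpow_dot.
  by rewrite I_odd ?addr0// => y; rewrite dot_refl_orth.
by move=> y; rewrite /u' dotB dotZ; ring.
Qed.

Hypothesis hd : (0 < d)%N.

Let N0 : d%:R != 0 :> R. Proof. by rewrite pnatr_eq0 -lt0n. Qed.

Let e0 : 'rV[R]_d.+1 := delta_mx ord0 ord0.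

Lemma I_coco r i j : i != j ->
  I (fun y => co y i * co y j * expR (r * co y ord0)) = 0.
Proof.
have bE : bmf (fun y : S => expR (r * co y ord0)).
  by apply/bmf_exp/bmfM; [exact: bmf_cst | exact: bmf_co].
have H (k l : 'I_d.+1) : k != l -> k != ord0 ->
    I (fun y => co y k * co y l * expR (r * co y ord0)) = 0.
  move=> kl k0; rewrite (@eq_I _ _ _ _ _ (fun y => dot (delta_mx ord0 k) y *
      (dot (delta_mx ord0 l) y * expR (r * dot e0 y)))).
    rewrite I_odd//.
      by apply: bmfM; [exact: bmf_dot|under eq_fun do rewrite dot_delta].
    move=> y; rewrite !dot_refl_orth// inner_delta mxE eqxx /=; apply/eqP.
      by rewrite pnatr_eq0 eqb0 eq_sym.
    by rewrite pnatr_eq0 eqb0 eq_sym.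
  by move=> y; rewrite !dot_delta mulrA.
move=> ij; have [i0|i0] := eqVneq i ord0; last exact: H.
rewrite (@eq_I _ _ _ _ _ (fun y => co y j * co y i * expR (r * co y ord0))).
  by apply: H; rewrite -?i0 eq_sym.
by move=> y; rewrite (mulrC (co y i)).
Qed.

(** Swapping two coordinates other than the first makes all these integrals equal, and together with
    [xpow 2 r] they add up to [xpow 0 r] because the squared coordinates sum to 1. *)
Lemma I_cosqr r i : i != ord0 ->
  I (fun y => co y i ^+ 2 * expR (r * co y ord0)) = (xpow 0 r - xpow 2 r) / d%:R.
Proof.
have bE : bmf (fun y : S => expR (r * co y ord0)).
  by apply/bmf_exp/bmfM; [exact: bmf_cst | exact: bmf_co].
have bc k : bmf (fun y : S => co y k ^+ 2 * expR (r * co y ord0)).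
  by apply: bmfM => //; apply: bmfX; exact: bmf_co.
have H (k l : 'I_d.+1) : k != ord0 -> l != ord0 ->
    I (fun y => co y k ^+ 2 * expR (r * co y ord0)) =
    I (fun y => co y l ^+ 2 * expR (r * co y ord0)).
  move=> k0 l0; rewrite -(I_refl (delta_mx ord0 k - delta_mx ord0 l) (bc k)).
  apply: eq_I => y /=; rewrite -!dot_delta dot_refl_swap.
    rewrite (@dot_refl_orth e0)// innerBr !inner_delta !mxE eqxx/=.
    by rewrite !(eq_sym ord0) (negbTE k0) (negbTE l0) subrr.
  by rewrite !inner_delta !mxE !eqxx.
move=> i0; suff : xpow 0 r = xpow 2 r + d%:R *
    I (fun y => co y i ^+ 2 * expR (r * co y ord0)).
  by move=> ->; field.
transitivity (I (fun y => \sum_k co y k ^+ 2 * expR (r * co y ord0))).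
  by apply: eq_I => y; rewrite -mulr_suml co_sqr_sum expr0.
rewrite I_sum// (bigD1 ord0)//=; congr (_ + _).
rewrite (eq_bigr (fun=> I (fun y => co y i ^+ 2 * expR (r * co y ord0)))).
  rewrite sumr_const mulr_natl; congr (_ *+ _).
  by rewrite cardC1 card_ord.
by move=> k k0; exact: H.
Qed.

(** An instance of the Funk-Hecke formula, for the harmonic <u,y> <v,y> of degree 2. After moving
    [x] to the first basis vector, mixed coordinate products integrate to 0 and the squares other
    than the first share the value [C]. *)
Lemma isotropy2 (x : S) u v r : inner u v = 0 ->
  I (fun y => dot u y * dot v y * expR (r * dot (sphere_val x) y)) =
  inner u (sphere_val x) * inner v (sphere_val x) *
  ((d.+1%:R * xpow 2 r - xpow 0 r) / d%:R).
Proof.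
move=> uv; pose O := householder (sphere_val x - e0).
have OO : O *m O^T = 1%:M := householder_orth _.
have xx : inner (sphere_val x) (sphere_val x) = inner e0 e0.
  by rewrite inner_delta mxE !eqxx sphere_sqr.
have bb u1 v1 p : bmf (fun y : S => dot u1 y * dot v1 y * expR (r * dot p y)).
  apply: bmfM; first by apply: bmfM; exact: bmf_dot.
  by apply/bmf_exp/bmfM; [exact: bmf_cst | exact: bmf_dot].
rewrite -(I_refl (sphere_val x - e0) (bb u v (sphere_val x))).
pose u1 := u *m O; pose v1 := v *m O.
have xO : sphere_val x *m O = e0.
  apply/rowP => i; rewrite -[LHS]inner_delta -[RHS]inner_delta innerC [RHS]innerC.
  have d1 : inner (delta_mx ord0 i : 'rV[R]_d.+1) (delta_mx ord0 i) = 1.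
    by rewrite inner_delta mxE !eqxx.
  by have := dot_refl_swap (mks d1) xx; rewrite /refl dot_act householderT.
have u1v1 : inner u1 v1 = 0 by rewrite inner_orthogonal.
have -> : inner u (sphere_val x) = u1 ord0 ord0.
  by rewrite -(inner_orthogonal _ _ OO) xO innerC inner_delta.
have -> : inner v (sphere_val x) = v1 ord0 ord0.
  by rewrite -(inner_orthogonal _ _ OO) xO innerC inner_delta.
rewrite (@eq_I _ _ _ _ _ (fun y => \sum_i \sum_j (u1 ord0 i * v1 ord0 j) *
    (co y i * co y j * expR (r * co y ord0)))); last first.
  move=> y /=; rewrite dot_refl_swap// dot_delta /refl !dot_act householderT.
  rewrite !dotE -/O -/u1 -/v1 mulr_suml mulr_suml; apply: eq_bigr => i _.
  by rewrite mulr_sumr mulr_suml; apply: eq_bigr => j _; ring.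
have bc k l : bmf (fun y : S => co y k * co y l * expR (r * co y ord0)).
  apply: bmfM; first by apply: bmfM; exact: bmf_co.
  by apply/bmf_exp/bmfM; [exact: bmf_cst | exact: bmf_co].
have bc' a k l : bmf (fun y : S => a * (co y k * co y l * expR (r * co y ord0))).
  by apply: bmfM => //; exact: bmf_cst.
rewrite I_sum => [|i]; last exact: bmf_sum.
rewrite (eq_bigr (fun i => (u1 ord0 i * v1 ord0 i) *
    I (fun y => co y i ^+ 2 * expR (r * co y ord0)))); last first.
  move=> i _; rewrite I_sum// (bigD1 i)//= big1 ?addr0.
    by rewrite IZ.
  by move=> j ji; rewrite IZ// I_coco ?mulr0// eq_sym.
set C := (xpow 0 r - xpow 2 r) / d%:R.
(* The common value [C] can be split off from every diagonal term because <u1,v1> = 0; only the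
   excess at the first coordinate survives. *)
rewrite (eq_bigr (fun i => C * (u1 ord0 i * v1 ord0 i) +
   (if i == ord0 then (xpow 2 r - C) * (u1 ord0 i * v1 ord0 i) else 0))).
  rewrite big_split/= -mulr_sumr [X in C * X]u1v1 mulr0 add0r -big_mkcond/=.
  by rewrite big_pred1_eq /C -natr1; field.
move=> i _; case: eqVneq => [->|i0]; first by rewrite -/(xpow 2 r); ring.
by rewrite I_cosqr// -/C; ring.
Qed.

End Isotropy.

(** * The Taylor remainder of the exponential *)

Section ExpTaylor.
Variable R : realType.

Definition exp_partial_sum n (s : R) : R := \sum_(i < n) s ^+ i / i`!%:R.

Lemma fact_addn_le i n : (i`! * n`! <= (n + i)`!)%N.
Proof.
rewrite -(bin_fact (leq_addr i n)) addKn (mulnC i`!).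
by rewrite leq_pmull// bin_gt0 leq_addr.
Qed.

(** The tail of the series is bounded termwise by (n+i)! >= n! i!, which factors out |s|^n / n! and
    leaves partial sums of exp |s|. *)
Lemma exp_taylor n (s : R) :
  `|expR s - exp_partial_sum n s| <= `|s| ^+ n * expR `|s| / n`!%:R.
Proof.
have cvs : [sequence series (exp_coeff s) (m + n)%N]_m @ \oo --> expR s.
  by rewrite cvg_shiftn; exact: is_cvg_series_exp_coeff.
have cv : (fun m => `|series (exp_coeff s) (m + n)%N - exp_partial_sum n s|) @ \oo -->
    `|expR s - exp_partial_sum n s|.
  by apply: cvg_norm; apply: cvgB; [exact: cvs | exact: cvg_cst].
rewrite -(cvg_lim _ cv)//; apply: limr_le; first by apply/cvg_ex; eexists; exact: cv.
apply: nearW => m.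
rewrite addnC; have -> : series (exp_coeff s) (n + m)%N - exp_partial_sum n s =
    \sum_(i < m) s ^+ (n + i) / (n + i)`!%:R.
  rewrite /series /= big_mkord big_split_ord/= addrAC.
  by rewrite [X in X + _](_ : _ = 0) ?add0r//; apply/eqP; rewrite subr_eq0.
apply: (le_trans (ler_norm_sum _ _ _)).
apply: (@le_trans _ _ (`|s| ^+ n / n`!%:R * \sum_(i < m) `|s| ^+ i / i`!%:R)).
  rewrite mulr_sumr; apply: ler_sum => i _.
  rewrite normrM normrX exprD normfV [X in _ / X]ger0_norm ?ler0n//.
  rewrite mulrACA ler_wpM2l ?mulr_ge0 ?exprn_ge0//.
  rewrite -invfM -natrM lef_pV2 ?posrE ?ltr0n ?fact_gt0 ?muln_gt0 ?fact_gt0//.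
  by rewrite ler_nat mulnC fact_addn_le.
rewrite mulrAC ler_wpM2r ?invr_ge0 ?ler0n// ler_wpM2l ?exprn_ge0//.
have -> : \sum_(i < m) `|s| ^+ i / i`!%:R = series (exp_coeff `|s|) m.
  by rewrite /series /= big_mkord.
apply: nondecreasing_cvgn_le; last exact: is_cvg_series_exp_coeff.
apply: nondecreasing_series => i _ _.
by rewrite /exp_coeff /= divr_ge0 ?exprn_ge0 ?ler0n.
Qed.

Lemma expX_fact_cvg0 (x : R) : (fun n => x ^+ n / n`!%:R) @ \oo --> (0 : R).
Proof. exact: cvg_exp_coeff. Qed.

End ExpTaylor.

(** * Moments and exponential integrals *)

Section Moments.
Context {R : realType} {dT : measure_display} {T : measurableType dT}.
Variable mu : probability T R.
Local Notation I f := (\int[mu]_y f y).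
Variables (g w : T -> R) (M : R).
Hypotheses (bg : bmf g) (gM : forall y, `|g y| <= M).
Hypotheses (bw : bmf w) (w1 : forall y, `|w y| <= 1).

Lemma bmf_gw j : bmf (fun y => g y * w y ^+ j).
Proof. by apply: bmfM => //; exact: bmfX. Qed.

Lemma bmf_gexp r : bmf (fun y => g y * expR (r * w y)).
Proof. by apply: bmfM => //; apply/bmf_exp/bmfM => //; exact: bmf_cst. Qed.

Lemma I_exp_taylor n r :
  `|I (fun y => g y * expR (r * w y)) -
    \sum_(i < n) r ^+ i / i`!%:R * I (fun y => g y * w y ^+ i)| <=
  M * (`|r| ^+ n * expR `|r| / n`!%:R).
Proof.
have bm i : bmf (fun y => r ^+ i / i`!%:R * (g y * w y ^+ i)).
  by apply: bmfM; [exact: bmf_cst | exact: bmf_gw].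
rewrite (eq_bigr (fun i : 'I_n => I (fun y => r ^+ i / i`!%:R * (g y * w y ^+ i)))).
  rewrite -(@I_sum _ _ _ mu _ _ _
      (fun (i : 'I_n) y => r ^+ i / i`!%:R * (g y * w y ^+ i)))// -IB.
  - apply: abs_I => [|y].
      by apply: bmfB; [exact: bmf_gexp | exact: bmf_sum].
    have -> : g y * expR (r * w y) - \sum_(i < n) r ^+ i / i`!%:R * (g y * w y ^+ i)
        = g y * (expR (r * w y) - exp_partial_sum n (r * w y)).
      rewrite mulrBr; congr (_ - _); rewrite mulr_sumr; apply: eq_bigr => i _.
      by rewrite exprMn; ring.
    have rw : `|r * w y| <= `|r| by rewrite normrM ler_piMr.
    rewrite normrM ler_pM//; apply: (le_trans (exp_taylor _ _)).
    rewrite ler_wpM2r ?invr_ge0 ?ler0n// ler_pM ?exprn_ge0 ?expR_ge0 ?ler_expR//.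
    by rewrite lerXn2r ?nnegrE.
  - exact: bmf_gexp.
  - exact: bmf_sum.
by move=> i _; rewrite IZ//; exact: bmf_gw.
Qed.

Lemma I_exp_eq0 r : (forall i, I (fun y => g y * w y ^+ i) = 0) ->
  I (fun y => g y * expR (r * w y)) = 0.
Proof.
move=> g0; apply/eqP; rewrite -normr_le0.
have cv : (fun n => M * expR `|r| * (`|r| ^+ n / n`!%:R)) @ \oo --> (0 : R).
  rewrite -[X in _ --> X](mulr0 (M * expR `|r|)).
  apply: cvgMr; exact: expX_fact_cvg0.
rewrite -(cvg_lim _ cv)//; apply: limr_ge; first by apply/cvg_ex; eexists; exact: cv.
apply: nearW => n; have := I_exp_taylor n r.
rewrite big1 => [|i _]; last by rewrite g0 mulr0.
by rewrite subr0 => /le_trans; apply; rewrite le_eqVlt; apply/orP; left; apply/eqP; ring.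
Qed.

(** Zeros in [r] accumulating at 0 kill the Taylor coefficients in turn: once the moments below [i]
    vanish, a zero [r] bounds the [i]-th moment by [C * r], through the remainder estimate of order
    [i+1]. *)
Lemma moments_eq0 :
  (forall e, 0 < e -> exists2 r, 0 < r <= e & I (fun y => g y * expR (r * w y)) = 0) ->
  forall i, I (fun y => g y * w y ^+ i) = 0.
Proof.
move=> zr i; elim/ltn_ind: i => i IH.
have f0 : 0 < i`!%:R :> R by rewrite ltr0n fact_gt0.
have M0 : 0 <= M by exact: le_trans (normr_ge0 _) (gM point).
pose C := i`!%:R * (M * expR 1).
apply: (@le_harmonic_eq0 _ _ C) => n.
have [|r /andP[r0 rn] gr] := zr n.+1%:R^-1; first by rewrite invr_gt0 ltr0n.
have r1 : r <= 1 by rewrite (le_trans rn)// invf_le1 ?ler1n ?ltr0n.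
have := I_exp_taylor i.+1 r.
rewrite gr sub0r normrN big_ord_recr/= big1 => [|j _]; last by rewrite IH ?mulr0.
rewrite add0r normrM ger0_norm ?divr_ge0 ?exprn_ge0 ?(ltW r0) ?(ltW f0)//.
move=> h; apply: (@le_trans _ _ (C * r)); last by rewrite ler_wpM2l// !mulr_ge0 ?expR_ge0 ?(ltW f0).
rewrite (ger0_norm (ltW r0)) in h.
have ri0 : 0 < r ^+ i / i`!%:R by rewrite divr_gt0 ?exprn_gt0.
rewrite -(ler_pM2l ri0); apply: (le_trans h).
have -> : r ^+ i / i`!%:R * (C * r) = M * (r ^+ i.+1 * expR 1).
  by rewrite /C exprSr; field; rewrite gt_eqF.
rewrite ler_wpM2l// ler_pdivrMr ?ltr0n ?fact_gt0//.
rewrite -mulrA ler_wpM2l ?exprn_ge0 ?(ltW r0)//.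
apply: (@le_trans _ _ (expR 1)); first by rewrite ler_expR.
by rewrite ler_peMr ?expR_ge0// ler1n fact_gt0.
Qed.

End Moments.

(** The constant depends on [n] only and obeys C_(n+1) = n + 2 C_n, since |a + t b| <= 2. For
    [n = 0] the exponent [n.-1] is 0 and its factor [n%:R] vanishes. *)
Lemma expr_taylor1 (R : realType) n : exists2 C : R, 0 <= C &
  forall a b t : R, `|a| <= 1 -> `|b| <= 1 -> 0 <= t <= 1 ->
  `|(a + t * b) ^+ n - a ^+ n - t * (n%:R * b * a ^+ n.-1)| <= C * t ^+ 2.
Proof.
elim: n => [|n [C C0 IH]].
  exists 0 => // a b t _ _ _.
  by rewrite !expr0 !mul0r mulr0 subrr subr0 normr0.
exists (n%:R + 2 * C) => [|a b t a1 b1 t01]; first by rewrite addr_ge0 ?mulr_ge0.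
have {IH} := IH _ _ _ a1 b1 t01; set r := (X in `|X| <= _) => rC.
have /andP[t0 t1] := t01.
have -> : (a + t * b) ^+ n.+1 - a ^+ n.+1 - t * (n.+1%:R * b * a ^+ n) =
    n%:R * (t ^+ 2 * (b ^+ 2 * a ^+ n.-1)) + (a + t * b) * r.
  rewrite /r; clear -n; case: n => [|n] /=; first by rewrite !expr0; ring.
  by rewrite !exprS -!natr1; ring.
apply: (le_trans (ler_normD _ _)); rewrite [leRHS]mulrDl lerD//.
  rewrite normrM ger0_norm// ler_wpM2l// normrM ger0_norm ?sqr_ge0//.
  by rewrite ler_piMr ?sqr_ge0// normrM !normrX mulr_ile1 ?exprn_ge0 ?exprn_ile1.
rewrite normrM -mulrA ler_pM//.
rewrite (le_trans (ler_normD _ _))// normrM (ger0_norm t0).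
have : t * `|b| <= 1 by rewrite mulr_ile1.
lra.
Qed.

(** * Radial functions and the recursion for their moments *)

Section MomentRecursion.
Variables (R : realType) (d : nat).
Local Notation S := (sphere R d).
Variable sigma : probability S R.
Local Notation I f := (\int[sigma]_y f y).
Hypothesis hd : (0 < d)%N.

(** The exponent starts at 1: for the degree-2 multiplier [beta] one factor <v,y> is taken by the
    test function itself. *)
Definition radial (g : S -> R) := forall (u v : 'rV[R]_d.+1) k, inner u v = 0 ->
  I (fun y => g y * dot u y * dot v y ^+ k.+1) = 0.

Variable g : S -> R.
Hypotheses (bg : bmf g) (rg : radial g).

(* First-order expansion in t of the orthogonality for the pair f - t e, e + t f. *)
Lemma radial_second (e f : 'rV[R]_d.+1) k :
    inner e e = 1 -> inner f f = 1 -> inner e f = 0 ->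
  k.+1%:R * I (fun y => g y * (dot f y ^+ 2 * dot e y ^+ k)) =
  I (fun y => g y * dot e y ^+ k.+2).
Proof.
move=> e1 f1 ef; apply/eqP; rewrite -subr_eq0; apply/eqP.
have [_ [M gM]] := bg.
have M0 : 0 <= M by exact: le_trans (normr_ge0 _) (gM point).
have [C C0 HC] := @expr_taylor1 R k.+1.
have le1 u y : inner u u = 1 -> `|@dot R d u y| <= 1.
  by move=> u1; have := dot_le1 (mks u1) y.
have bd u := @bmf_dot R d u.
have bc (a : R) := @bmf_cst R _ S a.
apply: (@le_harmonic_eq0 _ _ (M * (k.+1%:R + 2 * C))) => m.
set t := m.+1%:R^-1.
have t0 : 0 < t by rewrite invr_gt0 ltr0n.
have t1 : t <= 1 by rewrite invf_le1 ?ltr0n// ler1n.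
pose rem y := (dot e y + t * dot f y) ^+ k.+1 - dot e y ^+ k.+1 -
  t * (k.+1%:R * dot f y * dot e y ^+ k).
have brem : bmf rem by rewrite /rem; solve_bmf.
have remC y : `|rem y| <= C * t ^+ 2.
  by apply: HC; rewrite ?le1 ?(ltW t0).
have orth : inner (f - t *: e) (e + t *: f) = 0.
  by rewrite !(innerBl, innerDr, innerZl, innerZr) e1 f1 (innerC f) ef; ring.
have H1 := rg k orth; have H2 : inner f e = 0 by rewrite innerC.
have {}H2 := rg k H2.
set D := (X in `|X|).
(* [Q] gathers the terms of second order in [t]. Its integral is O(t^2), so dividing [key] by [t]
   bounds [D] by a multiple of [t = 1/(m+1)]. *)
pose Q y := g y * (- (k.+1%:R * t ^+ 2 * (dot f y * dot e y ^+ k.+1)) +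
                   (dot f y - t * dot e y) * rem y).
have bQ : bmf Q by rewrite /Q; solve_bmf.
have b1 : bmf (fun y => g y * (dot f y ^+ 2 * dot e y ^+ k)).
  solve_bmf.
have b2 : bmf (fun y => g y * dot e y ^+ k.+2).
  solve_bmf.
have b3 : bmf (fun y => g y * dot f y * dot e y ^+ k.+1).
  solve_bmf.
have key : t * D = - I Q.
  apply/eqP; rewrite -subr_eq0 opprK; apply/eqP; rewrite -[RHS]H1.
  rewrite [RHS](@eq_I _ _ _ _ _ (fun y => g y * dot f y * dot e y ^+ k.+1 +
    (t * (k.+1%:R * (g y * (dot f y ^+ 2 * dot e y ^+ k)) -
         g y * dot e y ^+ k.+2) + Q y))); last first.
    move=> y; rewrite dotB dotD !dotZ /Q /rem; move: ((dot e y + t * dot f y) ^+ k.+1) => X.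
    by rewrite !exprS !expr0; ring.
  have b1' : bmf (fun y => k.+1%:R * (g y * (dot f y ^+ 2 * dot e y ^+ k))).
    by apply: bmfM.
  have b4 := bmfB b1' b2.
  have b4' : bmf (fun y => t * (k.+1%:R * (g y * (dot f y ^+ 2 * dot e y ^+ k)) -
         g y * dot e y ^+ k.+2)) by apply: bmfM.
  rewrite ID ?ID ?IZ ?IB ?IZ//; last exact: bmfD.
  by rewrite H2 add0r.
have Qle : `|I Q| <= M * (k.+1%:R + 2 * C) * t ^+ 2.
  apply: abs_I => // y; rewrite /Q normrM -[leRHS]mulrA ler_pM//.
  apply: (le_trans (ler_normD _ _)); rewrite [leRHS]mulrDl lerD//.
    rewrite normrN normrM ger0_norm ?mulr_ge0 ?sqr_ge0 ?(ltW t0)//.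
    rewrite ler_piMr ?mulr_ge0 ?sqr_ge0 ?(ltW t0)// normrM normrX.
    rewrite mulr_ile1 ?exprn_ge0 ?exprn_ile1//.
      exact: le1.
    exact: le1.
  rewrite normrM -[leRHS]mulrA ler_pM//.
  rewrite (le_trans (ler_normB _ _))// normrM (ger0_norm (ltW t0)).
  have h1 := le1 _ y e1; have h2 := le1 _ y f1.
  have : t * `|dot e y| <= 1 by rewrite mulr_ile1 ?(ltW t0).
  lra.
rewrite -(ler_pM2l t0) -{1}(ger0_norm (ltW t0)) -normrM key normrN.
by apply: (le_trans Qle); rewrite expr2 [leRHS]mulrC -!mulrA.
Qed.

Local Notation e_ i := (delta_mx ord0 i : 'rV[R]_d.+1).

Lemma inner_deltas (i j : 'I_d.+1) : inner (e_ i) (e_ j) = (i == j)%:R.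
Proof. by rewrite inner_delta mxE eqxx. Qed.

Let bm j k l : bmf (fun y => g y * (co y j ^+ k * co y ord0 ^+ l)).
Proof. solve_bmf. Qed.

Lemma radial_co (j : 'I_d.+1) k : j != ord0 ->
  k.+1%:R * I (fun y => g y * (co y j ^+ 2 * co y ord0 ^+ k)) =
  I (fun y => g y * co y ord0 ^+ k.+2).
Proof.
move=> j0.
rewrite [RHS](@eq_I _ _ _ _ _ (fun y => g y * dot (e_ ord0) y ^+ k.+2)); last first.
  by move=> y; rewrite dot_delta.
rewrite -(@radial_second _ (e_ j)) ?inner_deltas ?eqxx// 1?eq_sym ?(negbTE j0)//.
by congr (_ * _); apply: eq_I => y; rewrite !dot_delta.
Qed.

Lemma I_trace k : I (fun y => g y * co y ord0 ^+ k) =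
  \sum_j I (fun y => g y * (co y j ^+ 2 * co y ord0 ^+ k)).
Proof.
rewrite -I_sum//; apply: eq_I => y.
by rewrite -mulr_sumr -mulr_suml co_sqr_sum mul1r.
Qed.

(** Insert sum_j y_j^2 = 1 into the moment of order [k] and multiply by [k+1]: by [radial_co] each
    of the [d] indices other than 0 contributes one moment of order [k+2]. *)
Lemma radial_moment_rec k : (k.+1 + d)%:R * I (fun y => g y * co y ord0 ^+ k.+2) =
  k.+1%:R * I (fun y => g y * co y ord0 ^+ k).
Proof.
rewrite [in RHS]I_trace (bigD1 ord0)//= mulrDr mulr_sumr.
rewrite (eq_bigr (fun=> I (fun y => g y * co y ord0 ^+ k.+2))); last first.
  by move=> j j0; exact: radial_co.
rewrite sumr_const cardC1 card_ord natrD mulrDl; congr (_ + _).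
  by congr (_ * _); apply: eq_I => y; rewrite -exprD.
by rewrite mulr_natl.
Qed.

(** The exponent 0 is absent from [radial], so the first moment takes a separate argument: the trace
    identity gives m_1 = m_3, its other terms being radial integrals with exponent 2, while the
    recursion gives (d+2) m_3 = 2 m_1. *)
Lemma radial_moment1 : I (fun y => g y * co y ord0) = 0.
Proof.
have H : I (fun y => g y * co y ord0) = I (fun y => g y * co y ord0 ^+ 3).
  under eq_I do rewrite -[co _ _]expr1.
  rewrite I_trace (bigD1 ord0)//= big1 ?addr0 => [|j j0].
    by apply: eq_I => y; rewrite -exprD.
  rewrite -[RHS](@rg (e_ ord0) (e_ j) 1) ?inner_deltas 1?eq_sym ?(negbTE j0)//.
  by apply: eq_I => y; rewrite !dot_delta; ring.
have E : I (fun y => g y * co y ord0 ^+ 1) = I (fun y => g y * co y ord0).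
  by apply: eq_I => y; rewrite expr1.
have := radial_moment_rec 1; rewrite -H E natrD mulrDl => /eqP.
rewrite -subr_eq0 addrAC subrr add0r mulf_eq0 pnatr_eq0 (gtn_eqF hd)/=.
by move/eqP.
Qed.

Lemma radial_moments_eq0 k : I g = 0 -> I (fun y => g y * co y ord0 ^+ k) = 0.
Proof.
move=> g0; elim/ltn_ind: k => -[|[|k]] IH.
- by under eq_I do rewrite expr0 mulr1.
- by under eq_I do rewrite expr1; exact: radial_moment1.
have := radial_moment_rec k; rewrite (IH k) ?ltnS ?leqnSn//.
by rewrite mulr0 => /eqP; rewrite mulf_eq0 pnatr_eq0 /= => /eqP.
Qed.

Lemma radial_moments_co_eq0 (j : 'I_d.+1) k : I g = 0 -> j != ord0 ->
  I (fun y => g y * (co y j ^+ 2 * co y ord0 ^+ k)) = 0.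
Proof.
move=> g0 j0; have := radial_co k j0; rewrite radial_moments_eq0// => /eqP.
by rewrite mulf_eq0 pnatr_eq0 /= => /eqP.
Qed.

(** All moments in the first coordinate vanish by [radial_moments_eq0]. Applied to
    [alpha - I alpha], this allows a multiplier to be replaced by its mean under the exponential. *)
Lemma radial_exp j r : I g = 0 ->
  I (fun y => g y * co y ord0 ^+ j * expR (r * co y ord0)) = 0.
Proof.
move=> g0; have [_ [M HM]] : bmf (fun y => g y * co y ord0 ^+ j).
  by apply: bmfM => //; apply: bmfX; exact: bmf_co.
apply: (@I_exp_eq0 _ _ _ _ _ (fun y => co y ord0) M) => //.
- by apply: bmfM => //; apply: bmfX; exact: bmf_co.
- exact: bmf_co.
- by move=> y; exact: co_le1.
by move=> i; under eq_I do rewrite -mulrA -exprD; exact: radial_moments_eq0.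
Qed.

Lemma radial_exp2 (j : 'I_d.+1) r : I g = 0 -> j != ord0 ->
  I (fun y => g y * co y j ^+ 2 * expR (r * co y ord0)) = 0.
Proof.
move=> g0 j0; have bgj : bmf (fun y => g y * co y j ^+ 2).
  by apply: bmfM => //; apply: bmfX; exact: bmf_co.
have [_ [M HM]] := bgj.
apply: (@I_exp_eq0 _ _ _ _ _ (fun y => co y ord0) M) => //.
- exact: bmf_co.
- by move=> y; exact: co_le1.
by move=> i; under eq_I do rewrite -mulrA; exact: radial_moments_co_eq0.
Qed.

End MomentRecursion.

(** * Expectations under von Mises-Fisher laws *)

Section MeanUnderMF.
Variables (R : realType) (d : nat).
Local Notation S := (sphere R d).
Variable sigma : probability S R.
Hypothesis hsigma : is_uniform sigma.
Local Notation I f := (\int[sigma]_y f y).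
Local Notation Z := (xpow sigma 0).

Lemma bmf_expdot r (x : S) : bmf (fun y => expR (r * dot (sphere_val x) y)).
Proof. solve_bmf. Qed.

Lemma expdot_ge r (x y : S) : 0 <= r -> expR (- r) <= expR (r * dot (sphere_val x) y).
Proof.
move=> r0; rewrite ler_expR -mulrN1 ler_wpM2l//.
by have := dot_le1 x y; rewrite ler_norml => /andP[].
Qed.

Lemma expdot_le r (x y : S) : 0 <= r -> expR (r * dot (sphere_val x) y) <= expR r.
Proof.
move=> r0; rewrite ler_expR ler_piMr//.
by have := dot_le1 x y; rewrite ler_norml => /andP[].
Qed.

Lemma Z_dot (x : S) r : I (fun y => expR (r * dot (sphere_val x) y)) = Z r.
Proof. by rewrite -(xpow_dot hsigma x); apply: eq_I => y; rewrite mul1r. Qed.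

Lemma Z_gt0 r : 0 <= r -> 0 < Z r.
Proof.
move=> r0; rewrite -(Z_dot point); apply: (@lt_le_trans _ _ (expR (- r))).
  exact: expR_gt0.
rewrite -{1}(I_cst sigma (expR (- r))); apply: le_I => [||y]; first exact: bmf_cst.
  exact: bmf_expdot.
exact: expdot_ge.
Qed.

Lemma Z_le r : 0 <= r -> Z r <= expR r.
Proof.
move=> r0; rewrite -(Z_dot point) -(I_cst sigma (expR r)).
apply: le_I => [||y]; [exact: bmf_expdot|exact: bmf_cst|exact: expdot_le].
Qed.

(** Normalised by the integral of the exponential itself instead of the closed form with a Bessel
    function; [mean_MF] identifies the two. *)
Definition vmf_mean (r : R) (x : S) (f : S -> R) : R :=
  I (fun y => f y * expR (r * dot (sphere_val x) y)) / Z r.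

Lemma mean_functional r x : 0 <= r -> bdd_functional (vmf_mean r x).
Proof.
move=> r0; have b := bmf_expdot r x; have Z0 := Z_gt0 r0.
split=> [a f g bf bg|f M bf fM]; rewrite /vmf_mean.
  have bf' := bmfM bf b; have bg' := bmfM bg b.
  rewrite mulrA -mulrDl -IZ// -ID//; last by apply: bmfM => //; exact: bmf_cst.
  by congr (_ / _); apply: eq_I => y; ring.
have Iexp c : I (fun y => c * expR (r * dot (sphere_val x) y)) = c * Z r.
  by rewrite (IZ sigma c b) Z_dot.
have bexp c : bmf (fun y => c * expR (r * dot (sphere_val x) y)).
  exact: (bmfM (bmf_cst c) b).
set J := Rintegral _ _ _.
have hJ : - (M * Z r) <= J <= M * Z r.
  rewrite -mulNr -!Iexp; apply/andP; split.
    apply: (le_I sigma (bexp _) (bmfM bf b)) => y; rewrite ler_wpM2r ?expR_ge0//.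
    by have := fM y; rewrite ler_norml => /andP[].
  apply: (le_I sigma (bmfM bf b) (bexp _)) => y; rewrite ler_wpM2r ?expR_ge0//.
  by have := fM y; rewrite ler_norml => /andP[].
by rewrite ler_norml ler_pdivlMr// ler_pdivrMr// mulNr.
Qed.

Lemma mean_cst r x c : 0 <= r -> vmf_mean r x (fun=> c) = c.
Proof.
move=> r0; rewrite /vmf_mean IZ; last exact: bmf_expdot.
by rewrite Z_dot mulfK// gt_eqF// Z_gt0.
Qed.

(** Testing with the whole sphere forces [c] to be the inverse of [Z rho], whatever closed form it
    comes in. *)
Lemma mean_MF rho (x : S) (c : R) (L : (S -> R) -> R) :
  0 < rho -> bdd_functional L -> L (fun=> 1) = 1 ->
  (forall A, measurable A ->
    L \1_A = I (fun y => \1_A y * (c * expR (rho * dot (sphere_val x) y)))) ->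
  forall f, bmf f -> L f = vmf_mean rho x f.
Proof.
move=> rho0 FL L1 LA; have r0 := ltW rho0; have b := bmf_expdot rho x.
have cE : c = (Z rho)^-1.
  have := LA setT measurableT; have -> : \1_setT = (fun=> 1) :> (S -> R).
    by apply/funext => y; rewrite indicT.
  rewrite L1 => /esym; under eq_I do rewrite mul1r.
  rewrite IZ// Z_dot => h; apply: (mulIf (lt0r_neq0 (Z_gt0 r0))).
  by rewrite h mulVf// gt_eqF// Z_gt0.
apply: bdd_functional_ext => //; first exact: mean_functional.
move=> A mA; rewrite LA// /vmf_mean.
have bA := bmf_indic (R := R) mA.
rewrite -IZr; last exact: bmfM.
by apply: eq_I => y; rewrite cE; ring.
Qed.

End MeanUnderMF.

(** * Expectations along the Markov process *)

Section MarkovMean.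
Variables (R : realType) (d : nat).
Local Notation S := (sphere R d).
Variable sigma : probability S R.
Hypothesis hsigma : is_uniform sigma.
Context (dO : measure_display) (Omega : measurableType dO).
Variable X : homogeneous_markov_process R Omega S.
Hypothesis HX : forall (eta : S) (t : R), 0 < t ->
        exists2 rho : R, 0 < rho &
          forall A : set S, measurable A ->
            transition X t eta A = MF sigma eta rho A.

Definition pmean (t : R) (x : S) (f : S -> R) : R :=
  \int[mp_law X x]_w f (mp_path X t w).

Lemma pmean_functional t x : 0 <= t -> bdd_functional (pmean t x).
Proof. by move=> t0; apply: I_functional; exact: mp_measurable. Qed.

Lemma pmean_indic t x A : 0 <= t -> measurable A ->
  pmean t x \1_A = fine (mp_law X x (mp_path X t @^-1` A)).
Proof.
move=> t0 mA; rewrite -I_indic//.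
by rewrite -[X in measurable X]setTI; exact: mp_measurable.
Qed.

Lemma pmean_mean t x : 0 < t -> exists2 rho, 0 < rho &
  forall f, bmf f -> pmean t x f = vmf_mean sigma rho x f.
Proof.
move=> t0; have [rho rho0 H] := HX x t0; exists rho => //.
pose c := rho `^ lambda R d / (2 `^ lambda R d * Gamma (lambda R d + 1) *
  besselI (lambda R d) rho).
apply: (mean_MF hsigma (c := c)) => //.
- exact/pmean_functional/ltW.
- by rewrite /pmean I_cst.
move=> A mA; rewrite pmean_indic ?(ltW t0)//.
rewrite -[mp_law X x _]/(transition X t x A) H// /MF.
rewrite -[fine _]/(\int[sigma]_(y in A) MF_density x rho y) Rintegral_mkcond.
apply: eq_I => y; rewrite patchE indicE; case: ifP => _; last by rewrite mul0r.
by rewrite mul1r.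
Qed.

Lemma pmean_bmf t f : 0 < t -> bmf f -> bmf (fun x => pmean t x f).
Proof.
move=> t0 bf; split; last first.
  by have [_ [M fM]] := bf; exists M => x; apply: (pmean_functional x (ltW t0)).2.
move: f bf; apply: bmf_ind.
- move=> A mA; apply/measurable_EFinP.
  have mt : measurable (mp_path X t @^-1` A).
    by rewrite -[X in measurable X]setTI; apply: mp_measurable => //; exact: ltW.
  rewrite (_ : _ \o _ = fun x => mp_law X x (mp_path X t @^-1` A)).
    by apply: mp_kernel => //; exact: ltW.
  apply/funext => x /=; rewrite (pmean_indic _ (ltW t0) mA) fineK//.
  exact: fin_num_measure.
- move=> a f g bf bg mf mg.
  under eq_fun do rewrite (pmean_functional _ (ltW t0)).1//.
  by apply: measurable_funD => //; apply: measurable_funM.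
move=> f_ f bf_ bf mf_ ff.
apply: (@measurable_fun_cvg _ _ _ _ (fun n x => pmean t x (f_ n))) => // x _.
apply/cvgrPdist_le => e e0; near=> n.
rewrite -(bdd_functionalB (pmean_functional x (ltW t0)))//.
apply: (le_trans ((pmean_functional x (ltW t0)).2 _ n.+1%:R^-1 _ _)).
- exact: bmfB.
- by move=> y; rewrite distrC.
by apply: ltW; near: n; exact: near_infty_natSinv_lt (PosNum e0).
Unshelve. all: end_near. Qed.

(** The Markov property for the sure event settles indicators, and both sides are bounded
    functionals of [f]. *)
Lemma pmean_CK s t x f : 0 < s -> 0 < t -> bmf f ->
  pmean (s + t) x f = pmean s x (fun y => pmean t y f).
Proof.
move=> s0 t0; have [s0' t0'] := (ltW s0, ltW t0).
move: f; apply: bdd_functional_ext.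
- by apply: pmean_functional; rewrite addr_ge0.
- have F := pmean_functional x s0'; split=> [a f g bf bg|f M bf fM].
    rewrite -F.1; try exact: pmean_bmf.
    by congr pmean; apply/funext => y; rewrite (pmean_functional y t0').1.
  apply: F.2; first exact: pmean_bmf.
  by move=> y; exact: (pmean_functional y t0').2.
move=> A mA; rewrite pmean_indic ?addr_ge0// -(setTI (_ @^-1` _)).
rewrite mp_markov//; last first.
  by rewrite -(setD0 setT); apply: sigma_algebraCD; exact: sigma_algebra0.
rewrite /pmean /Rintegral; congr fine; apply: eq_integral => w _.
rewrite -[LHS]fineK; first by congr EFin; exact/esym/pmean_indic.
apply: fin_num_measure.
by rewrite -[X in measurable X]setTI; exact: mp_measurable.
Qed.

End MarkovMean.

(** * Estimates for the mean resultant lengths *)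

Section MeanFacts.
Variables (R : realType) (d : nat).
Local Notation S := (sphere R d).
Variable sigma : probability S R.
Hypothesis hsigma : is_uniform sigma.
Hypothesis hd : (0 < d)%N.
Local Notation I f := (\int[sigma]_y f y).
Local Notation X j := (xpow sigma j).
Local Notation mean := (vmf_mean sigma).

Let dR : 0 < d%:R :> R. Proof. by rewrite ltr0n. Qed.

Lemma mean_le r (x : S) f g : 0 <= r -> bmf f -> bmf g -> (forall y, f y <= g y) ->
  mean r x f <= mean r x g.
Proof.
move=> r0 bf bg fg; rewrite /vmf_mean.
rewrite ler_wpM2r ?invr_ge0 ?(ltW (Z_gt0 _ _))//.
by apply: le_I => [||y]; [apply: bmfM => //; exact: bmf_expdot|
  apply: bmfM => //; exact: bmf_expdot|rewrite ler_wpM2r ?expR_ge0].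
Qed.

Lemma radial1 : radial sigma (fun=> 1).
Proof.
move=> u v k uv.
rewrite (@eq_I _ _ _ _ _ (fun y => dot u y * dot v y ^+ k.+1)) => [|y]; last first.
  by rewrite mul1r.
apply: I_odd => // [|y]; first by solve_bmf.
by rewrite dot_refl_orth// innerC.
Qed.

Definition moment k := I (fun y => co y ord0 ^+ k).

Lemma momentE k : moment k = I (fun y => 1 * co y ord0 ^+ k).
Proof. by apply: eq_I => y; rewrite mul1r. Qed.

Lemma uniform_moment0 : moment 0 = 1.
Proof. by rewrite /moment (I_cst sigma 1). Qed.

Lemma uniform_moment_odd : moment 1 = 0.
Proof.
rewrite momentE -(radial_moment1 hd (bmf_cst 1) radial1).
by apply: eq_I => y; rewrite expr1.
Qed.

Lemma uniform_moment_rec k : moment k.+2 = k.+1%:R / (k.+1 + d)%:R * moment k.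
Proof.
have h : (k.+1 + d)%:R != 0 :> R by rewrite pnatr_eq0.
have := radial_moment_rec (bmf_cst 1) radial1 k; rewrite -!momentE => e.
by apply: (mulfI h); rewrite e mulrA mulrCA divff// mulr1.
Qed.

Lemma xpow_taylor j n r :
  `|X j r - \sum_(i < n) r ^+ i / i`!%:R * moment (j + i)| <=
  `|r| ^+ n * expR `|r| / n`!%:R.
Proof.
have := @I_exp_taylor _ _ _ sigma (fun y => co y ord0 ^+ j) (fun y => co y ord0) 1 _ _ _ _ n r.
rewrite mul1r => h; apply: le_trans (h _ _ _ _).
- rewrite le_eqVlt; apply/orP; left; apply/eqP; congr (`|_ - _|).
  by apply: eq_bigr => i _; congr (_ * _); apply: eq_I => y; rewrite exprD.
- by solve_bmf.
- by move=> y; rewrite normrX exprn_ile1// co_le1.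
- exact: bmf_co.
- by move=> y; exact: co_le1.
Qed.

(** Integration by parts on the sphere, carried out on power series: for an index j other than 0,
    [radial_co] for the constant 1 matches the coefficients of r times the integral of y_j^2 exp (r
    y_0) with those of the integral of y_0 exp (r y_0). By [I_cosqr] the former is expressed through
    [X 0] and [X 2]. *)
Lemma helmholtz r : 0 <= r -> r * (X 0 r - X 2 r) = d%:R * X 1 r.
Proof.
move=> r0; pose j : 'I_d.+1 := inord 1.
have j0 : j != ord0 by rewrite -val_eqE/= inordK.
have J := I_cosqr hsigma hd r j0.
set J0 := Rintegral _ _ _ in J.
suff : r * J0 = X 1 r.
  by move=> <-; rewrite J; field; rewrite gt_eqF.
apply/eqP; rewrite -subr_eq0; apply/eqP.
have bj : bmf (fun y : S => co y j ^+ 2) by solve_bmf.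
have cv : (fun n => r * (r ^+ n / n`!%:R) * expR r + r ^+ n.+1 / n.+1`!%:R * expR r)
    @ \oo --> (0 : R).
  rewrite -[V in _ --> V](_ : r * 0 * expR r + 0 * expR r = 0); last by ring.
  have c0 := @expX_fact_cvg0 _ r.
  apply: cvgD; first by apply: cvgMl; apply: cvgMr.
  apply: cvgMl.
  rewrite -[V in V --> _]/([sequence r ^+ n.+1 / n.+1`!%:R]_n @ \oo).
  by rewrite (cvg_shiftS (fun n => r ^+ n / n`!%:R)).
apply/eqP; rewrite -normr_le0 -(cvg_lim _ cv)//.
apply: limr_ge; first by apply/cvg_ex; eexists; exact: cv.
apply: nearW => n.
have h1 : `|X 1 r - \sum_(i < n.+1) r ^+ i / i`!%:R * moment (1 + i)| <=
  r ^+ n.+1 / n.+1`!%:R * expR r.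
  by have := xpow_taylor 1 n.+1 r; rewrite (ger0_norm r0) mulrAC.
have h2 : `|J0 - \sum_(i < n) r ^+ i / i`!%:R *
    I (fun y => co y j ^+ 2 * co y ord0 ^+ i)| <= r ^+ n / n`!%:R * expR r.
  have := @I_exp_taylor _ _ _ sigma _ (fun y => co y ord0) 1 bj _ _ _ n r.
  rewrite mul1r (ger0_norm r0) mulrAC; apply.
  - by move=> y; rewrite normrX exprn_ile1// co_le1.
  - exact: bmf_co.
  - by move=> y; exact: co_le1.
(* The left sum has one more term; its term of index 0 contains the first moment, which is 0. *)
have e : \sum_(i < n.+1) r ^+ i / i`!%:R * moment (1 + i) =
    r * \sum_(i < n) r ^+ i / i`!%:R * I (fun y => co y j ^+ 2 * co y ord0 ^+ i).
  rewrite big_ord_recl/= uniform_moment_odd mulr0 add0r mulr_sumr.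
  apply: eq_bigr => i _; rewrite add1n momentE.
  have := radial_co (bmf_cst 1) radial1 i j0.
  rewrite (@eq_I _ _ _ _ (fun y => 1 * (co y j ^+ 2 * co y ord0 ^+ i))
     (fun y => co y j ^+ 2 * co y ord0 ^+ i)) => [<-|y]; last by rewrite mul1r.
  rewrite /bump leq0n add1n factS natrM exprS.
  by field; rewrite addrC natr1 !pnatr_eq0 -lt0n fact_gt0.
rewrite e in h1.
set s := \sum_(i < n) _ in h1 h2.
have -> : r * J0 - X 1 r = r * (J0 - s) - (X 1 r - r * s) by ring.
apply: (le_trans (ler_normB _ _)); rewrite lerD// normrM (ger0_norm r0) -mulrA.
by rewrite ler_wpM2l.
Qed.

(** [ratio1] is the mean resultant length. [ratio2] is the mean of ((d+1) s^2 - 1) / d with s =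
    <x,y>, the degree-2 Gegenbauer polynomial normalised to 1 at s = 1. *)
Definition ratio1 r := X 1 r / X 0 r.
Definition ratio2 r := (d.+1%:R * X 2 r - X 0 r) / d%:R / X 0 r.

Lemma mean_dot r (x : S) u : mean r x (dot u) = inner u (sphere_val x) * ratio1 r.
Proof. by rewrite /vmf_mean /ratio1 isotropy1// -mulrA. Qed.

Lemma mean_dot2 r (x : S) u v : inner u v = 0 ->
  mean r x (fun y => dot u y * dot v y) =
  inner u (sphere_val x) * inner v (sphere_val x) * ratio2 r.
Proof. by move=> uv; rewrite /vmf_mean /ratio2 isotropy2// -!mulrA. Qed.

Lemma mean_sqr r (x : S) : mean r x (fun y => dot (sphere_val x) y ^+ 2) = X 2 r / X 0 r.
Proof. by rewrite /vmf_mean xpow_dot. Qed.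

Lemma Z_ge1 r : 1 <= X 0 r.
Proof.
have bc := @bmf_co R d ord0.
have -> : 1 = I (fun y => 1 + r * co y ord0).
  rewrite ID; [|exact: bmf_cst|solve_bmf].
  rewrite I_cst IZ// (_ : Rintegral _ _ _ = 0) ?mulr0 ?addr0//.
  by rewrite -uniform_moment_odd; apply: eq_I => y; rewrite expr1.
apply: le_I => [||y]; [solve_bmf|solve_bmf|].
by rewrite expr0 mul1r expR_ge1Dx.
Qed.

Lemma xpow1_le r : 0 <= r -> X 1 r <= X 0 r.
Proof.
move=> r0; apply: le_I => [||y]; [solve_bmf|solve_bmf|].
rewrite ler_wpM2r ?expR_ge0// expr0 expr1.
exact: le_trans (ler_norm _) (co_le1 _ _).
Qed.

(** The density is at least exp (-r) / Z >= exp (-2r), and the uniform mean of 1 - y_0^2 is d /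
    (d+1). *)
Lemma xpow2_gap r : 0 <= r -> expR (- (2 * r)) * d%:R / d.+1%:R <= 1 - X 2 r / X 0 r.
Proof.
move=> r0; have Z0 := Z_gt0 hsigma r0.
have -> : 1 - X 2 r / X 0 r = (X 0 r - X 2 r) / X 0 r by rewrite mulrBl divff ?gt_eqF.
rewrite ler_pdivlMr//.
apply: (@le_trans _ _ (expR (- r) * d%:R / d.+1%:R)).
  have -> : expR (- (2 * r)) * d%:R / d.+1%:R * X 0 r =
      expR (- r) * d%:R / d.+1%:R * (X 0 r / expR r).
    have -> : - (2 * r) = - r - r by ring.
    by rewrite expRD !expRN; ring.
  rewrite ler_piMr ?mulr_ge0 ?expR_ge0 ?invr_ge0//.
  by rewrite ler_pdivrMr ?expR_gt0// mul1r Z_le.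
have -> : expR (- r) * d%:R / d.+1%:R = I (fun y => expR (- r) * (1 - co y ord0 ^+ 2)).
  rewrite IZ; last by solve_bmf.
  rewrite IB; [|exact: bmf_cst|solve_bmf].
  rewrite I_cst -/(moment 2) uniform_moment_rec uniform_moment0 mulr1 -mulrA.
  congr (_ * _); rewrite add1n -natr1; field.
  by rewrite natr1 pnatr_eq0.
rewrite -IB; [|solve_bmf|solve_bmf].
apply: le_I => [||y]; [solve_bmf|solve_bmf|].
rewrite expr0 -mulrBl mulrC; apply: ler_wpM2l.
  by rewrite subr_ge0 -real_normK ?num_real// exprn_ile1 ?co_le1.
rewrite ler_expR -mulrN1 ler_wpM2l//.
by have := co_le1 y ord0; rewrite ler_norml => /andP[].
Qed.

(** By [helmholtz] the ratio is r (1 - X 2 r / X 0 r) / d, to which [xpow2_gap] applies. *)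
Lemma ratio1_ge r : 0 <= r -> r * expR (- (2 * r)) / d.+1%:R <= ratio1 r.
Proof.
move=> r0; have Z0 := Z_gt0 hsigma r0; have := xpow2_gap r0.
have -> : ratio1 r = r * (1 - X 2 r / X 0 r) / d%:R.
  rewrite /ratio1; have := helmholtz r0; move: Z0.
  move: (X 0 r) (X 1 r) (X 2 r) => a b c a0 h.
  have -> : b = r * (a - c) / d%:R by rewrite h; field; rewrite gt_eqF.
  by field; rewrite !gt_eqF.
move=> /(ler_wpM2l r0) h; rewrite ler_pdivlMr//; apply: le_trans h.
by rewrite le_eqVlt; apply/orP; left; apply/eqP; ring.
Qed.

Lemma ratio1_ge0 r : 0 <= r -> 0 <= ratio1 r.
Proof.
move=> r0; apply: le_trans (ratio1_ge r0).
by rewrite !mulr_ge0 ?expR_ge0 ?invr_ge0.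
Qed.

Lemma ratio1_gt0 r : 0 < r -> 0 < ratio1 r.
Proof.
move=> r0; apply: lt_le_trans (ratio1_ge (ltW r0)).
by rewrite !mulr_gt0 ?expR_gt0 ?invr_gt0 ?ltr0n.
Qed.

(** This bounds [r] once [ratio1 r] stays away from 1. Split 1 - w = (1 - w^2) + (w^2 - w):
    [helmholtz] turns the first part into d X 1 <= d X 0, and the second integrand times [r] is at
    most 2. *)
Lemma param_le r : 0 < r -> r * (1 - ratio1 r) <= d.+2%:R.
Proof.
move=> r0; have Z0 := Z_gt0 hsigma (ltW r0).
have gap : X 2 r - X 1 r <= 2 / r.
  rewrite -(I_cst sigma (2 / r)) -IB; [|solve_bmf|solve_bmf].
  apply: le_I => [||y]; [solve_bmf|solve_bmf|].
  rewrite -mulrBl expr1; have := co_le1 y ord0; move: (co y ord0) => w.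
  rewrite ler_norml => /andP[w1 w2].
  have [w0|w0] := leP 0 w.
    apply: (@le_trans _ _ 0); last by rewrite divr_ge0// ltW.
    by rewrite mulr_le0_ge0 ?expR_ge0//; nra.
  rewrite ler_pdivlMr//.
  (* With s = - r w this is s exp (-s) <= 1, from exp s >= 1 + s. *)
  have h : - (r * w) * expR (r * w) <= 1.
    rewrite -[V in expR V]opprK; move: (- (r * w)) => s.
    rewrite expRN ler_pdivrMr ?expR_gt0// mul1r.
    by have := expR_ge1Dx s; lra.
  have E0 := expR_gt0 (r * w).
  have -> : (w ^+ 2 - w) * expR (r * w) * r = (1 - w) * (- (r * w) * expR (r * w)).
    by ring.
  have nn : 0 <= - (r * w) * expR (r * w) by rewrite mulr_ge0 ?expR_ge0//; nra.
  nra.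
rewrite /ratio1; have -> : r * (1 - X 1 r / X 0 r) = r * (X 0 r - X 1 r) / X 0 r.
  by field; rewrite gt_eqF.
rewrite ler_pdivrMr//.
have -> : r * (X 0 r - X 1 r) = r * (X 0 r - X 2 r) + r * (X 2 r - X 1 r) by ring.
rewrite (helmholtz (ltW r0)) -(addn2 d) natrD mulrDl lerD//.
  by rewrite ler_wpM2l// xpow1_le// ltW.
apply: (@le_trans _ _ 2); first by rewrite mulrC -ler_pdivlMr.
by rewrite ler_peMr// Z_ge1.
Qed.

End MeanFacts.

Lemma bounded_cvg (R : realType) (dT : measure_display) (T : measurableType dT)
    (mu : probability T R) (f_ : nat -> T -> R) (f : T -> R) (M : R) :
  (forall n, bmf (f_ n)) -> bmf f -> (forall n x, `|f_ n x| <= M) ->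
  (forall x, (f_ ^~ x) @ \oo --> f x) ->
  (fun n => \int[mu]_x f_ n x) @ \oo --> \int[mu]_x f x.
Proof.
move=> bf_ bf fM ff.
have [] := @dominated_convergence _ _ R mu setT measurableT
    (fun n => EFin \o f_ n) (EFin \o f) (fun=> M%:E).
- by move=> n; apply/measurable_EFinP; exact: (bf_ n).1.
- by apply/measurable_EFinP; exact: bf.1.
- by apply/aeW => x _; apply: cvg_EFin; [exact: nearW | exact: ff].
- exact: (bmf_integrable mu (bmf_cst M)).
- by apply/aeW => x n _ /=; rewrite lee_fin.
move=> _ _.
rewrite -[V in _ --> V](fineK (integrable_fin_num measurableT (bmf_integrable mu bf))).
by move=> /fine_cvgP[].
Qed.

(** * Decay of the concentration along integer times *)

Section Ergodicity.
Variables (R : realType) (d : nat).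
Local Notation S := (sphere R d).
Variable sigma : probability S R.
Hypothesis hsigma : is_uniform sigma.
Hypothesis hd : (0 < d)%N.
Local Notation I f := (\int[sigma]_y f y).
Local Notation mean := (vmf_mean sigma).
Local Notation ratio1 := (ratio1 sigma).

Variable r : nat -> S -> R.
Hypothesis r_gt0 : forall k x, 0 < r k x.
Hypothesis r_bmf : forall k f, bmf f -> bmf (fun x => mean (r k x) x f).
(** Index [k] stands for time [k+1], so the times j+1 and k+1 add up to the index (j+k)+1. *)
Hypothesis r_CK : forall j k x f, bmf f ->
  mean (r (j + k).+1 x) x f = mean (r j x) x (fun y => mean (r k y) y f).

Let r_ge0 k x : 0 <= r k x. Proof. exact: ltW. Qed.

#[local] Hint Resolve r_ge0 : core.

Let F k x := mean_functional hsigma x (r_ge0 k x).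

(** Measurability is known for kernels applied to test functions, so the mean resultant length is
    recovered as the sum over i of x_i times the mean of y_i. *)
Lemma bmf_ratio1 k : bmf (fun x => ratio1 (r k x)).
Proof.
rewrite (_ : (fun _ => _) = (fun x => \sum_i co x i *
   mean (r k x) x (dot (delta_mx ord0 i)))); last first.
  apply/funext => x; rewrite -[LHS]mul1r -(co_sqr_sum x) mulr_suml.
  by apply: eq_bigr => i _; rewrite mean_dot// inner_delta expr2 mulrA.
apply: bmf_sum => i; apply: bmfM; first exact: bmf_co.
by apply: r_bmf; exact: bmf_dot.
Qed.

(** Since w <= (1 + w^2) / 2, a second moment below 1 keeps the mean below 1. *)
Lemma ratio1_lt1 k x : ratio1 (r k x) < 1.
Proof.
have := mean_le hsigma x (r_ge0 k x) (bmf_dot (sphere_val x)) _ _.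
have g := xpow2_gap hsigma (r_ge0 k x).
have g0 : 0 < 1 - xpow sigma 2 (r k x) / xpow sigma 0 (r k x).
  by apply: lt_le_trans g; rewrite !mulr_gt0 ?expR_gt0 ?invr_gt0 ?ltr0n.
move=> /(_ (fun y => (1 + dot (sphere_val x) y ^+ 2) / 2)).
rewrite mean_dot// sphere_sqr mul1r => h.
apply: (@le_lt_trans _ _ (mean (r k x) x
  (fun y => (1 + dot (sphere_val x) y ^+ 2) / 2))).
  apply: h; first by solve_bmf.
  move=> y; rewrite ler_pdivlMr//.
  by have := sqr_ge0 (1 - dot (sphere_val x) y); nra.
rewrite (_ : (fun _ => _) = (fun y => 2^-1 * dot (sphere_val x) y ^+ 2 + 2^-1)).
  rewrite ((F k x).1 _ _ _ (bmfX 2 (bmf_dot _)) (bmf_cst _)).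
  by rewrite mean_cst ?r_ge0// mean_sqr//; lra.
by apply/funext => y; field.
Qed.

(** The first unit of time already spreads the mass: later times contribute only factors in [0,1],
    so [ratio1 (r k.+1 x)] is at most the mean of |<x,y>| under the time-1 law, hence at most
    (1+q)/2 < 1 for every [k]. Then [param_le] applies. *)
Lemma param_bounded x : exists2 C, 0 < C & forall k, r k.+1 x <= C.
Proof.
have [q qE] : exists q, q = xpow sigma 2 (r 0 x) / xpow sigma 0 (r 0 x) by eexists.
have g0 : 0 < 1 - q.
  rewrite qE; apply: lt_le_trans (xpow2_gap hsigma (r_ge0 0 x)).
  by rewrite !mulr_gt0 ?expR_gt0 ?invr_gt0 ?ltr0n.
have H k : ratio1 (r k.+1 x) <= (1 + q) / 2.
  have e : ratio1 (r k.+1 x) =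
      mean (r 0 x) x (fun y => dot (sphere_val x) y * ratio1 (r k y)).
    have := mean_dot hsigma (r k.+1 x) x (sphere_val x).
    rewrite sphere_sqr mul1r => <-.
    rewrite (r_CK 0 k x (bmf_dot (sphere_val x))).
    by congr vmf_mean; apply/funext => y; exact: mean_dot.
  have b := bmf_ratio1 k; have bd := bmfX 2 (bmf_dot (sphere_val x)).
  have bs := bmfD (bmfM (bmf_cst 2^-1) bd) (bmf_cst 2^-1).
  rewrite e.
  apply: (@le_trans _ _ (mean (r 0 x) x
      (fun y => 2^-1 * dot (sphere_val x) y ^+ 2 + 2^-1))).
    apply: mean_le; [by []|exact: r_ge0|exact: (bmfM (bmf_dot _) b)|exact: bs|move=> y].
    have a0 := ratio1_ge0 hsigma hd (r_ge0 k y); have a1 := ltW (ratio1_lt1 k y).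
    set a := ratio1 _ in a0 a1 *; set w := dot _ _.
    apply: (@le_trans _ _ `|w|).
      by rewrite (le_trans (ler_norm _))// normrM (ger0_norm a0) ler_piMr.
    rewrite -[w ^+ 2]real_normK ?num_real//; move: `|w| => v.
    have -> : 2^-1 * v ^+ 2 + 2^-1 = v + (v - 1) ^+ 2 / 2 by field.
    by rewrite lerDl divr_ge0// sqr_ge0.
  rewrite ((F 0 x).1 _ _ _ bd (bmf_cst _)) mean_cst ?r_ge0// mean_sqr//.
  by rewrite -qE; lra.
exists (d.+2%:R / ((1 - q) / 2)) => [|k].
  by rewrite !divr_gt0// ltr0n.
rewrite ler_pdivlMr; last by lra.
apply: le_trans (param_le hsigma hd (r_gt0 k.+1 x)).
by rewrite ler_wpM2l ?r_ge0//; have := H k; lra.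
Qed.

(** The starting points whose unit-time law is too concentrated for a minorisation with constant
    [gap m]. The level is put on [ratio1 (r 0 y)], which is measurable by [bmf_ratio1]. *)
Definition large m := [set y : S | 1 - m.+1%:R^-1 < ratio1 (r 0 y)].

Lemma measurable_large m : measurable (large m).
Proof.
rewrite (_ : large m = setT `&` (fun y => ratio1 (r 0 y)) @^-1`
    `]1 - m.+1%:R^-1, +oo[).
  by apply: (bmf_ratio1 0).1.
by apply/seteqP; split => y /=; rewrite /large/= in_itv/= andbT // => -[].
Qed.

(** By [ratio1_lt1] every point eventually leaves [large m], and dominated convergence applies. *)
Lemma large_cvg0 : (fun m => I \1_(large m)) @ \oo --> (0 : R).
Proof.
rewrite -(I_cst sigma 0).
apply: (@bounded_cvg _ _ _ _ _ _ 1).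
- by move=> n; apply: bmf_indic; exact: measurable_large.
- exact: bmf_cst.
- by move=> n x; rewrite indicE; case: (_ \in _); rewrite ?normr1 ?normr0.
move=> x; have e0 : 0 < 1 - ratio1 (r 0 x) by rewrite subr_gt0 ratio1_lt1.
apply: cvg_near_cst; near=> m.
rewrite indicE memNset// /large /=; apply/negP; rewrite -leNgt.
rewrite lerBrDl -lerBrDr ltW//; near: m; exact: near_infty_natSinv_lt (PosNum e0).
Unshelve. all: end_near. Qed.

(** The density is at most exp C / Z, and Z >= 1. *)
Lemma mean_large k x C m : r k.+1 x <= C ->
  `|mean (r k.+1 x) x \1_(large m)| <= expR C * I \1_(large m).
Proof.
move=> rC; have bL := bmf_indic (R := R) (measurable_large m).
have i0 y : 0 <= \1_(large m) y :> R by rewrite indicE; case: (_ \in _).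
have nn : 0 <= mean (r k.+1 x) x \1_(large m).
  rewrite -(mean_cst hsigma x 0 (r_ge0 k.+1 x)).
  by apply: mean_le => //; exact: bmf_cst.
rewrite ger0_norm// ler_pdivrMr ?Z_gt0//.
apply: (@le_trans _ _ (expR C * I \1_(large m))); last first.
  by rewrite ler_peMr ?Z_ge1// mulr_ge0 ?expR_ge0// I_ge0.
rewrite -IZ//; apply: le_I => [||y].
- by apply: bmfM => //; exact: bmf_expdot.
- by apply: (@bmfM _ _ _ (fun=> expR C)) => //; exact: bmf_cst.
rewrite mulrC ler_wpM2r// (le_trans (expdot_le _ _ (r_ge0 _ _)))//.
by rewrite ler_expR.
Qed.

(** Off [large m], [param_le] gives r 0 y <= (d+2)(m+1), and the density is at least exp (-2 r 0
    y). *)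
Definition gap m : R := expR (- (2 * (d.+2%:R * m.+1%:R))).

Lemma gap01 m : 0 < gap m < 1.
Proof. by rewrite /gap expR_gt0 expR_lt1 oppr_lt0 !mulr_gt0 ?ltr0n. Qed.

(** The density minus [gap m], called [p], is nonnegative with total mass [1 - gap m], so it
    integrates a function bounded by 1 to at most that mass in absolute value. *)
Lemma minorization m y g : bmf g -> (forall z, `|g z| <= 1) -> ~ large m y ->
  `|mean (r 0 y) y g - gap m * I g| <= 1 - gap m.
Proof.
move=> bg g1 /negP; rewrite -leNgt => lm.
have r0 := r_ge0 0 y; have Z0 := Z_gt0 hsigma r0; have /andP[e0 e1] := gap01 m.
have rle : r 0 y <= d.+2%:R * m.+1%:R.
  rewrite -ler_pdivrMr ?ltr0n//; apply: le_trans (param_le hsigma hd (r_gt0 0 y)).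
  by rewrite ler_wpM2l//; move: lm; rewrite /= lerBrDl -lerBrDr.
have be := bmf_expdot (r 0 y) y.
pose p z := expR (r 0 y * dot (sphere_val y) z) / xpow sigma 0 (r 0 y) - gap m.
have bp : bmf p by rewrite /p; solve_bmf.
have p0 z : 0 <= p z.
  rewrite subr_ge0 ler_pdivlMr//.
  apply: le_trans (expdot_ge y z r0).
  apply: (@le_trans _ _ (gap m * expR (r 0 y))).
    by rewrite ler_wpM2l ?Z_le// ltW.
  by rewrite /gap -expRD ler_expR; lra.
have Ip : I p = 1 - gap m.
  rewrite IB; [|solve_bmf|exact: bmf_cst].
  by rewrite I_cst IZr// Z_dot// divff// gt_eqF.
have -> : mean (r 0 y) y g - gap m * I g = I (fun z => g z * p z).
  rewrite /vmf_mean -IZ// -IZr; last by solve_bmf.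
  rewrite -IB; [|solve_bmf|solve_bmf].
  by apply: eq_I => z; rewrite /p; ring.
have bgp := bmfM bg bp.
rewrite -Ip ler_norml; apply/andP; split.
  rewrite -mulN1r -IZ//; apply: le_I => // [|z]; first by solve_bmf.
  by have := g1 z; rewrite ler_norml => /andP[h _]; rewrite ler_wpM2r.
by apply: le_I => // z; have := g1 z; rewrite ler_norml => /andP[_ h]; rewrite ler_piMl.
Qed.

Section Contraction.
Variables (x x' : S) (C : R) (m : nat).
Hypotheses (rx : forall k, r k.+1 x <= C) (rx' : forall k, r k.+1 x' <= C).

Let diff k g := mean (r k.+1 x) x g - mean (r k.+1 x') x' g.
Let eta := 4 * (expR C * I \1_(large m)).

(* Off [large m] the kernel dominates [gap m] times the uniform distribution, and
   on [large m] the two laws carry little mass since their densities are at most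
   [expR C]; hence the total variation distance contracts up to an error [eta]. *)
Lemma contraction k g : bmf g -> (forall y, `|g y| <= 1) ->
  diff k g <= (1 - gap m) ^+ k * 2 + eta.
Proof.
have /andP[e0 e1] := gap01 m; have e1' : 0 < 1 - gap m by rewrite subr_gt0.
have bL := bmf_indic (R := R) (measurable_large m).
have eta0 : 0 <= eta by rewrite !mulr_ge0 ?expR_ge0// I_ge0// => y; rewrite indicE.
elim: k g => [|k IH] g bg g1.
  rewrite expr0 mul1r; have h := (F 1 x).2 _ _ bg g1; have h' := (F 1 x').2 _ _ bg g1.
  apply: (@le_trans _ _ 2); last by rewrite lerDl.
  rewrite (_ : 2 = 1 + 1); last by ring.
  rewrite /diff (le_trans (ler_norm _))// (le_trans (ler_normB _ _))//.
  exact: (lerD h h').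
pose Pg y := mean (r 0 y) y g.
have bPg : bmf Pg by exact: r_bmf.
have Pg1 y : `|Pg y| <= 1 by apply: (F 0 y).2.
have Ig1 : `|I g| <= 1 by exact: abs_I.
(* [q] is [I g] off [large m] and [Pg] on it. Removing [gap m * q] from [Pg] and rescaling leaves a
   function [h] still bounded by 1, to which the induction hypothesis applies. *)
pose q y := I g + \1_(large m) y * (Pg y - I g).
have bq0 : bmf (fun y => \1_(large m) y * (Pg y - I g)) by solve_bmf.
have bq : bmf q by rewrite /q; solve_bmf.
pose h y := (Pg y - gap m * q y) / (1 - gap m).
have bh : bmf h by rewrite /h; solve_bmf.
have h1 y : `|h y| <= 1.
  rewrite normrM normfV (ger0_norm (ltW e1')) ler_pdivrMr// mul1r /q indicE.
  case: (boolP (y \in large m)) => [_|/negP yL].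
    rewrite mul1r (_ : Pg y - _ = (1 - gap m) * Pg y); last by ring.
    rewrite normrM.
    by rewrite (ger0_norm (ltW e1')) ler_piMr ?(ltW e1').
  rewrite mul0r addr0; apply: minorization => // Ly; apply: yL.
  by rewrite inE.
have step j z : mean (r j.+2 z) z g = (1 - gap m) * mean (r j.+1 z) z h +
    gap m * (I g + mean (r j.+1 z) z (fun y => \1_(large m) y * (Pg y - I g))).
  rewrite -{1}(addn0 j.+1) r_CK//.
  have -> : (fun y => mean (r 0 y) y g) = (fun y => (1 - gap m) * h y + gap m * q y).
    apply/funext => y; rewrite -/(Pg y) /h mulrCA divff ?gt_eqF// mulr1.
    by rewrite subrK.
  have bgq : bmf (fun y => gap m * q y) by solve_bmf.
  rewrite (F j.+1 z).1//; congr (_ + _).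
  have -> : (fun y => gap m * q y) = (fun y => gap m * q y + (fun=> 0) y).
    by apply/funext => y; rewrite addr0.
  rewrite (F j.+1 z).1//; last exact: bmf_cst.
  rewrite mean_cst// addr0; congr (_ * _).
  have -> : q = (fun y => I g * (fun=> 1) y + \1_(large m) y * (Pg y - I g)).
    by apply/funext => y; rewrite mulr1.
  rewrite (F j.+1 z).1//; last exact: bmf_cst.
  by rewrite mean_cst// mulr1.
(* |Pg - I g| <= 2 and [mean_large] give half of [eta] for each of the two starting points. *)
have rest z (rz : forall k, r k.+1 z <= C) :
    `|mean (r k.+1 z) z (fun y => \1_(large m) y * (Pg y - I g))| <= eta / 2.
  have bP : bmf (fun y => \1_(large m) y * (Pg y - I g)) by solve_bmf.
  have lin (c : R) : mean (r k.+1 z) z (fun y => c * \1_(large m) y + (fun=> 0) y) =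
      c * mean (r k.+1 z) z \1_(large m).
    by rewrite (F k.+1 z).1 ?mean_cst ?addr0//; exact: bmf_cst.
  have blin (c : R) : bmf (fun y : S => c * \1_(large m) y + (fun=> 0) y).
    apply: bmfD; last exact: bmf_cst.
    by apply: (@bmfM _ _ _ (fun=> c)); [exact: bmf_cst | exact: bL].
  have := mean_large m (rz k); rewrite ler_norml => /andP[_ mL].
  have Pg2 y : `|Pg y - I g| <= 2.
    rewrite (le_trans (ler_normB _ _))// (_ : 2 = 1 + 1); last by ring.
    by rewrite lerD.
  have i0 y : 0 <= \1_(large m) y :> R by rewrite indicE.
  have : -2 * mean (r k.+1 z) z \1_(large m) <=
      mean (r k.+1 z) z (fun y => \1_(large m) y * (Pg y - I g)).
    rewrite -lin; apply: mean_le => // y; rewrite addr0 mulrC ler_wpM2l//.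
    by have := Pg2 y; rewrite ler_norml => /andP[].
  have : mean (r k.+1 z) z (fun y => \1_(large m) y * (Pg y - I g)) <=
      2 * mean (r k.+1 z) z \1_(large m).
    rewrite -lin; apply: mean_le => // y; rewrite addr0 mulrC ler_wpM2r//.
    by have := Pg2 y; rewrite ler_norml => /andP[].
  by rewrite /eta ler_norml => *; apply/andP; split; lra.
have := IH h bh h1; have := rest x rx; have := rest x' rx'.
rewrite /diff !step exprS !ler_norml.
set b' := vmf_mean _ _ _ (fun y => \1_(large m) y * _).
set b := vmf_mean _ _ _ (fun y => \1_(large m) y * _).
set a := vmf_mean _ _ _ h; set a' := vmf_mean _ _ _ h.
move=> /andP[b'1 b'2] /andP[b1 b2] /(ler_wpM2l (ltW e1')) aa.
(* The error does not accumulate, as (1 - gap m) eta + gap m eta = eta. *)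
have bb : gap m * (b - b') <= gap m * eta by rewrite ler_wpM2l ?(ltW e0)//; lra.
move: aa bb; move: (_ ^+ k) (I g) => t u aa bb.
lra.
Qed.

End Contraction.

(** Apply [contraction] to <x,.> from [x] and from [-x]: the difference of the means is a sum of two
    nonnegative ratios, one of them [ratio1 (r k.+1 x)]. As the concentration is bounded,
    [ratio1_ge] passes the decay from the ratio to [r]. *)
Lemma param_cvg0 x : (r ^~ x) @ \oo --> (0 : R).
Proof.
pose xN : 'rV[R]_d.+1 := - sphere_val x.
have xN1 : inner xN xN = 1 by rewrite innerNl innerNr opprK sphere_sqr.
pose x' := mks xN1.
have [C1 C10 H1] := param_bounded x; have [C2 C20 H2] := param_bounded x'.
pose C := C1 + C2.
have rx k : r k.+1 x <= C by apply: (le_trans (H1 k)); rewrite lerDl ltW.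
have rx' k : r k.+1 x' <= C by apply: (le_trans (H2 k)); rewrite lerDr ltW.
have key k m : ratio1 (r k.+1 x) <=
    (1 - gap m) ^+ k * 2 + 4 * (expR C * I \1_(large m)).
  apply: le_trans (contraction m rx rx' k (bmf_dot (sphere_val x)) _).
    rewrite !mean_dot// sphere_sqr mul1r lerDl innerNr sphere_sqr mulN1r opprK.
    exact: ratio1_ge0.
  by move=> y; exact: dot_le1.
have bnd k : r k.+1 x <= d.+1%:R * expR (2 * C) * ratio1 (r k.+1 x).
  have h := ratio1_ge hsigma hd (r_ge0 k.+1 x).
  have E0 := expR_gt0 (2 * r k.+1 x).
  rewrite [V in V <= _](_ : _ = d.+1%:R * expR (2 * r k.+1 x) *
      (r k.+1 x * expR (- (2 * r k.+1 x)) / d.+1%:R)); last first.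
    by rewrite expRN; field; rewrite (gt_eqF E0) addrC natr1 pnatr_eq0.
  apply: (@le_trans _ _ (d.+1%:R * expR (2 * r k.+1 x) * ratio1 (r k.+1 x))).
    by rewrite ler_wpM2l// mulr_ge0 ?expR_ge0.
  rewrite ler_wpM2r ?ratio1_ge0// ler_wpM2l// ler_expR ler_wpM2l//.
suff : (fun k => r k.+1 x) @ \oo --> (0 : R) by rewrite -(cvg_shiftS (r ^~ x)).
have cvr : (fun k => ratio1 (r k.+1 x)) @ \oo --> (0 : R).
  apply/cvgrPdist_le => e e0.
  (* First [m] makes the error term small, then [k] the geometric term with this [m] fixed. *)
  have [m lm] : exists m, 4 * (expR C * I \1_(large m)) <= e / 2.
    have E0 : 0 < e / 2 / (4 * expR C) by rewrite !divr_gt0 ?mulr_gt0 ?expR_gt0.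
    have /cvgrPdist_le/(_ _ E0)[m _ /(_ m (leqnn m))] := large_cvg0.
    rewrite /= sub0r normrN => /(le_trans (ler_norm _)).
    by rewrite ler_pdivlMr ?mulr_gt0 ?expR_gt0// => h; exists m; lra.
  have /andP[g0 g1] := gap01 m.
  have gc : (fun k => (1 - gap m) ^+ k * 2) @ \oo --> (0 : R).
    rewrite -[V in _ --> V](mul0r 2); apply: cvgMl.
    by apply: cvg_expr; rewrite ger0_norm; lra.
  near=> k.
  rewrite sub0r normrN ger0_norm; last exact: ratio1_ge0.
  apply: (le_trans (key k m)); rewrite [leRHS](splitr e) lerD//.
  rewrite (le_trans (ler_norm _))// -normrN -sub0r.
  near: k; move/cvgrPdist_le : gc; apply; lra.
apply: (@squeeze_cvgr _ _ _ _ (fun=> 0) (fun k => d.+1%:R * expR (2 * C) * ratio1 (r k.+1 x))).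
- by apply: nearW => k; rewrite r_ge0 bnd.
- exact: cvg_cst.
rewrite -[V in _ --> V](mulr0 (d.+1%:R * expR (2 * C))).
exact: cvgMr.
Unshelve. all: end_near. Qed.

End Ergodicity.

(** * Expansion of the quotient of resultant lengths at small concentration *)

Section SmallParameter.
Variables (R : realType) (d : nat).
Variable sigma : probability (sphere R d) R.
Hypothesis hsigma : is_uniform sigma.
Hypothesis hd : (0 < d)%N.
Local Notation X j := (xpow sigma j).
Local Notation m := (moment sigma).

Let N : R := d.+1%:R.
Let N0 : 0 < N. Proof. by rewrite ltr0n. Qed.
Let NE k : (k.+1 + d)%:R = N + k%:R :> R.
Proof. by rewrite addSnnS addnC natrD. Qed.

Lemma uniform_moments : [/\ m 0 = 1, m 2 = N^-1, m 4 = 3 / (N * (N + 2)) &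
  m 6 = 15 / (N * (N + 2) * (N + 4))].
Proof.
have N2 : N + 2 != 0 by rewrite gt_eqF// addr_gt0.
have N4 : N + 4 != 0 by rewrite gt_eqF// addr_gt0.
have nN := lt0r_neq0 N0.
rewrite !(uniform_moment_rec hsigma) !NE uniform_moment0.
move: (N) N2 N4 nN => n N2 N4 nN; rewrite !addr0.
by split => //; field; rewrite ?N2 ?N4 ?nN.
Qed.

Lemma uniform_moments_odd : [/\ m 1 = 0, m 3 = 0 & m 5 = 0].
Proof.
by rewrite !(uniform_moment_rec hsigma) (uniform_moment_odd hsigma hd) !mulr0.
Qed.

Variable t : nat -> R.
Hypotheses (t_gt0 : forall k, 0 < t k) (t_cvg : t @ \oo --> (0 : R)).

(** The remainder estimate of order [n+1] is o(t^n), which isolates the [n]-th Taylor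
    coefficient. *)
Lemma xpow_expansion j n :
  (fun k => (X j (t k) - \sum_(i < n) t k ^+ i / i`!%:R * m (j + i)) / t k ^+ n)
    @ \oo --> m (j + n) / n`!%:R.
Proof.
apply/cvgrPdist_le => e e0.
have h : (fun k => t k * expR 1) @ \oo --> (0 : R).
  by rewrite -[V in _ --> V](mul0r (expR 1)); exact: cvgMl.
near=> k; have tk := t_gt0 k; have tn : 0 < t k ^+ n by rewrite exprn_gt0.
have t1 : t k <= 1.
  rewrite (le_trans (ler_norm _))// -normrN -sub0r.
  by near: k; move/cvgrPdist_le : t_cvg; exact.
have := xpow_taylor sigma j n.+1 (t k); rewrite (ger0_norm (ltW tk)).
rewrite big_ord_recr/= opprD addrA; set A := X j _ - _ => hA.
have -> : m (j + n) / n`!%:R - A / t k ^+ n =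
    - ((A - t k ^+ n / n`!%:R * m (j + n)) / t k ^+ n).
  by field; rewrite gt_eqF//= pnatr_eq0 -lt0n fact_gt0.
rewrite normrN normrM normfV (ger0_norm (ltW tn)) ler_pdivrMr//.
apply: (le_trans hA); apply: (@le_trans _ _ (t k * expR 1 * t k ^+ n)).
  rewrite ler_pdivrMr ?ltr0n ?fact_gt0// exprS mulrAC -[leLHS]mulr1.
  apply: ler_pM => //; first by rewrite !mulr_ge0 ?expR_ge0 ?exprn_ge0// ltW.
    rewrite ler_wpM2r ?(ltW tn)// ler_wpM2l ?(ltW tk)//.
    by rewrite ler_expR.
  by rewrite ler1n fact_gt0.
rewrite ler_wpM2r ?(ltW tn)// (le_trans (ler_norm _))// -normrN -sub0r.
by near: k; move/cvgrPdist_le : h; exact.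
Unshelve. all: end_near. Qed.

(** Rescaled remainders of [X 0], [X 1], [X 2] after their terms below order 4, 3, 4. They have
    limits, and [XZ], [XY], [XW] are exact identities in them, so the asymptotics reduces to limits
    of rational expressions. *)
Let z k := (X 0 (t k) - (1 + t k * t k / 2 * m 2)) / t k ^+ 4.
Let y k := (X 1 (t k) - t k * m 2) / t k ^+ 3.
Let w k := (X 2 (t k) - (m 2 + t k * t k / 2 * m 4)) / t k ^+ 4.

Let z_cvg : z @ \oo --> m 4 / 24.
Proof.
have [m1 m3 m5] := uniform_moments_odd.
rewrite (_ : z = fun k => (X 0 (t k) -
  \sum_(i < 4) t k ^+ i / i`!%:R * m (0 + i)) / t k ^+ 4).
  exact: (@xpow_expansion 0 4).
apply/funext => k; rewrite /z; congr ((_ - _) / _).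
rewrite !big_ord_recr big_ord0/= !add0n m1 m3 uniform_moment0.
by rewrite !mulr0 fact0 (_ : 2`! = 2%N)//; field.
Qed.

Let y_cvg : y @ \oo --> m 4 / 6.
Proof.
have [m1 m3 m5] := uniform_moments_odd.
rewrite (_ : y = fun k => (X 1 (t k) -
  \sum_(i < 3) t k ^+ i / i`!%:R * m (1 + i)) / t k ^+ 3).
  exact: (@xpow_expansion 1 3).
apply/funext => k; rewrite /y; congr ((_ - _) / _).
rewrite !big_ord_recr big_ord0/= !addnE/= m1 m3.
by rewrite !mulr0 (_ : 1`! = 1%N)//; field.
Qed.

Let w_cvg : w @ \oo --> m 6 / 24.
Proof.
have [m1 m3 m5] := uniform_moments_odd.
rewrite (_ : w = fun k => (X 2 (t k) -
  \sum_(i < 4) t k ^+ i / i`!%:R * m (2 + i)) / t k ^+ 4).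
  exact: (@xpow_expansion 2 4).
apply/funext => k; rewrite /w; congr ((_ - _) / _).
rewrite !big_ord_recr big_ord0/= !addnE/= m3 m5.
by rewrite !mulr0 fact0 (_ : 2`! = 2%N)//; field.
Qed.

(** The coefficient of t^2 in N X 2 - X 0; the constant term N m_2 - 1 is 0. *)
Let c := (N * m 4 - m 2) / 2.

Let t0 k : t k != 0. Proof. by rewrite gt_eqF. Qed.
Let XZ k : X 0 (t k) = 1 + t k * t k * (m 2 / 2 + t k * t k * z k).
Proof. by rewrite /z; field. Qed.
Let XY k : X 1 (t k) = t k * (m 2 + t k * t k * y k).
Proof. by rewrite /y; field. Qed.
Let XW k : N * X 2 (t k) - X 0 (t k) =
  t k * t k * (c + t k * t k * (N * w k - z k)).
Proof.
have [_ m2 _ _] := uniform_moments; have nN := lt0r_neq0 N0.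
rewrite /w /z /c m2; move: (N) nN => n nN.
by field; rewrite nN t0.
Qed.

Let q k := ratio2 sigma (t k) / ratio1 sigma (t k) ^+ 2.

(** The factor t^2 of [XW] cancels against the square of the factor t of [XY]. *)
Let qE k : q k * (d%:R * (m 2 + t k * t k * y k) ^+ 2) =
  (c + t k * t k * (N * w k - z k)) * X 0 (t k).
Proof.
have Z0 := Z_gt0 hsigma (ltW (t_gt0 k)).
have Y0 : m 2 + t k * t k * y k != 0.
  have := ratio1_gt0 hsigma hd (t_gt0 k); rewrite /ratio1 XY.
  by apply: contraTneq => ->; rewrite mulr0 mul0r ltxx.
have d0 : d%:R != 0 :> R by rewrite pnatr_eq0 -lt0n.
rewrite /q /ratio2 /ratio1 -/N XW XY; field.
by rewrite Y0 t0 d0 gt_eqF.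
Qed.

Ltac cvg_step := lazymatch goal with
  | |- cvg_to _ (nbhs (_ - _)) => apply: cvgB
  | |- cvg_to _ (nbhs (_ + _)) => apply: cvgD
  | |- cvg_to _ (nbhs (_ * _)) => apply: cvgM
  | |- _ => first [exact: cvg_cst | assumption]
  end.
Ltac cvg_arith := move: (c) (N) (m 2) (m 4 / 24) (m 4 / 6) (m 6 / 24) (m 4) (z) (y) (w)
    z_cvg y_cvg w_cvg t_cvg => c' n m2' z0 y0 w0 m4' z' y' w' zc yc wc tc;
  do !cvg_step.

(** Every remainder in [qE] carries a factor t^2, and c = d / (N (N+2)) is nonzero. *)
Lemma ratio_limit :
  q @ \oo --> c / (d%:R * (m 2 * m 2)) /\ c / (d%:R * (m 2 * m 2)) != 0.
Proof.
have [_ m2 m4 _] := uniform_moments.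
have nN := lt0r_neq0 N0; have N2 : N + 2 != 0 by rewrite gt_eqF// addr_gt0.
have d0 : d%:R != 0 :> R by rewrite pnatr_eq0 -lt0n.
have dN : d%:R = N - 1 by rewrite /N -natr1 addrK.
have c0 : c = d%:R / (N * (N + 2)).
  rewrite /c m2 m4 dN; move: (N) nN N2 => n nN N2.
  by field; rewrite nN N2.
split; last by rewrite c0 m2 !(mulf_neq0, invr_neq0).
rewrite (_ : q = fun k => (c + t k * t k * (N * w k - z k)) *
    (1 + t k * t k * (m 2 / 2 + t k * t k * z k)) *
    (d%:R * ((m 2 + t k * t k * y k) * (m 2 + t k * t k * y k)))^-1); last first.
  apply/funext => k; rewrite -XZ -qE expr2 mulfK//.
  rewrite mulf_neq0// -expr2 expf_neq0//.
  have := ratio1_gt0 hsigma hd (t_gt0 k); rewrite /ratio1 XY.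
  by apply: contraTneq => ->; rewrite mulr0 mul0r ltxx.
rewrite (_ : c / _ = (c + 0 * 0 * (N * (m 6 / 24) - m 4 / 24)) *
    (1 + 0 * 0 * (m 2 / 2 + 0 * 0 * (m 4 / 24))) *
    (d%:R * ((m 2 + 0 * 0 * (m 4 / 6)) * (m 2 + 0 * 0 * (m 4 / 6))))^-1); last first.
  by rewrite !(mul0r, addr0) mulr1.
apply: cvgM; first by cvg_arith.
apply: cvgV; last by cvg_arith.
by rewrite !(mul0r, addr0) m2 !mulf_neq0// invr_neq0.
Qed.

(** The next coefficient is nonzero. [L] is the difference of the two sides of [qE], with the limit
    put for [q], divided by t^2; it would be 0 throughout, while it tends to -4 (N-1) / (N^2 (N+2)^2
    (N+4)). *)
Lemma ratio_not_constant : ~ (forall k, q k = c / (d%:R * (m 2 * m 2))).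
Proof.
have [_ m2 m4 m6] := uniform_moments.
have nN := lt0r_neq0 N0; have N2 : N + 2 != 0 by rewrite gt_eqF// addr_gt0.
have N4 : N + 4 != 0 by rewrite gt_eqF// addr_gt0.
have d0 : d%:R != 0 :> R by rewrite pnatr_eq0 -lt0n.
have dN : N - 1 != 0 by rewrite /N -natr1 addrK.
have m20 : m 2 != 0 by rewrite m2 invr_neq0.
move=> qc.
pose L k := c * (2 * y k / m 2 + t k * t k * (y k * y k) / (m 2 * m 2)) -
  (c * (m 2 / 2 + t k * t k * z k) +
   (N * w k - z k) * (1 + t k * t k * (m 2 / 2 + t k * t k * z k))).
have L0 k : L k = 0.
  have := qE k; rewrite qc XZ => e.
  have tt : t k * t k != 0 by rewrite mulf_neq0.
  apply: (mulfI tt); rewrite mulr0.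
  have -> : t k * t k * L k = c / (d%:R * (m 2 * m 2)) *
     (d%:R * (m 2 + t k * t k * y k) ^+ 2) -
    (c + t k * t k * (N * w k - z k)) * (1 + t k * t k * (m 2 / 2 + t k * t k * z k)).
    rewrite /L; move: (c) (N) (y k) (w k) (z k) => c' n y' w' z'.
    by field; rewrite m20 d0.
  by rewrite e subrr.
have Lc : L @ \oo --> c * (2 * (m 4 / 6) / m 2 +
    0 * 0 * (m 4 / 6 * (m 4 / 6)) / (m 2 * m 2)) -
  (c * (m 2 / 2 + 0 * 0 * (m 4 / 24)) +
   (N * (m 6 / 24) - m 4 / 24) * (1 + 0 * 0 * (m 2 / 2 + 0 * 0 * (m 4 / 24)))).
  by rewrite /L; cvg_arith.
have : L @ \oo --> (0 : R) by rewrite (_ : L = fun=> 0); [exact: cvg_cst | exact/funext].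
move=> /(cvg_unique (@Rhausdorff R) Lc) /eqP.
rewrite !(mul0r, addr0) mulr1 /c m2 m4 m6.
have -> : (N * (3 / (N * (N + 2))) - N^-1) / 2 * (2 * (3 / (N * (N + 2)) / 6) / N^-1) -
   ((N * (3 / (N * (N + 2))) - N^-1) / 2 * (N^-1 / 2) +
    (N * (15 / (N * (N + 2) * (N + 4)) / 24) - 3 / (N * (N + 2)) / 24)) =
   - 4 * (N - 1) / (N * N * (N + 2) * (N + 2) * (N + 4)).
  move: (N) nN N2 N4 => n nN N2 N4.
  by field; rewrite nN N2 N4.
by apply/negP; rewrite !(mulf_neq0, invr_neq0)// oppr_eq0 pnatr_eq0.
Qed.

(** A limit l = theta l other than 0 forces theta = 1, so the quotient is constant and equal to its
    limit, against [ratio_not_constant]. *)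
Lemma ratios_not_geometric theta : ~ (forall k,
  ratio2 sigma (t k.+1) / ratio1 sigma (t k.+1) ^+ 2 =
  theta * (ratio2 sigma (t k) / ratio1 sigma (t k) ^+ 2)).
Proof.
move=> qS; have [qc l0] := ratio_limit; set l := c / _ in qc l0.
have th1 : theta = 1.
  apply: (mulIf l0); rewrite mul1r.
  have h1 : (fun k => q k.+1) @ \oo --> theta * l.
    rewrite (_ : (fun k => _) = fun k => theta * q k); last exact/funext.
    exact: cvgMr.
  have h2 : (fun k => q k.+1) @ \oo --> l by rewrite (cvg_shiftS q).
  exact: (cvg_unique (@Rhausdorff R) h1 h2).
have qcst k : q k = q 0.
  by elim: k => [|k IH]; [by [] | rewrite -IH -[RHS]mul1r -th1; exact: qS].
apply: ratio_not_constant => k; rewrite qcst.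
apply: (cvg_unique (@Rhausdorff R) _ qc).
by rewrite (_ : q = fun=> q 0); [exact: cvg_cst | exact/funext].
Qed.

End SmallParameter.

(** * Radial multipliers, geometric decay and the contradiction *)

Section NoSemigroup.
Variables (R : realType) (d : nat).
Local Notation S := (sphere R d).
Variable sigma : probability S R.
Hypothesis hsigma : is_uniform sigma.
Hypothesis hd : (0 < d)%N.
Local Notation I f := (\int[sigma]_y f y).
Local Notation mean := (vmf_mean sigma).
Local Notation ratio1 := (ratio1 sigma).
Local Notation ratio2 := (ratio2 sigma).

Variable r : nat -> S -> R.
Hypothesis r_gt0 : forall k x, 0 < r k x.
Hypothesis r_bmf : forall k f, bmf f -> bmf (fun x => mean (r k x) x f).
Hypothesis r_CK : forall j k x f, bmf f ->
  mean (r (j + k).+1 x) x f = mean (r j x) x (fun y => mean (r k y) y f).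

Let r_ge0 k x : 0 <= r k x. Proof. exact: ltW. Qed.

#[local] Hint Resolve r_ge0 : core.

Let alpha x := ratio1 (r 0 x).
Let beta x := ratio2 (r 0 x).

Let bmf_alpha : bmf alpha. Proof. exact: bmf_ratio1. Qed.

(** As for [bmf_ratio1]: the mean of <x,y>^2 under the law started at [x] is expanded in products of
    coordinates, to which [r_bmf] applies, and [ratio2] is affine in it. *)
Lemma bmf_ratio2 : bmf beta.
Proof.
pose s x := \sum_i \sum_j co x i * co x j *
  mean (r 0 x) x (fun y => co y i * co y j).
have bs : bmf s.
  apply: bmf_sum => i; apply: bmf_sum => j; apply: bmfM.
    by apply: bmfM; exact: bmf_co.
  by apply: r_bmf; apply: bmfM; exact: bmf_co.
rewrite (_ : beta = fun x => (d.+1%:R * s x - 1) / d%:R); first by solve_bmf.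
apply/funext => x; rewrite /beta /ratio2.
have Z0 := Z_gt0 hsigma (r_ge0 0 x).
suff -> : s x = xpow sigma 2 (r 0 x) / xpow sigma 0 (r 0 x).
  by field; rewrite (gt_eqF Z0) pnatr_eq0 -lt0n hd.
rewrite -(mean_sqr hsigma _ x) /vmf_mean /s.
have b i j : bmf (fun y : S => co y i * co y j * expR (r 0 x * dot (sphere_val x) y)).
  by solve_bmf.
have b' i j : bmf (fun y : S => co x i * co x j *
    (co y i * co y j * expR (r 0 x * dot (sphere_val x) y))).
  by apply: (@bmfM _ _ _ (fun=> co x i * co x j)) => //; exact: bmf_cst.
rewrite [in RHS](@eq_I _ _ _ _ _ (fun y => \sum_i \sum_j co x i * co x j *
    (co y i * co y j * expR (r 0 x * dot (sphere_val x) y)))); last first.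
  move=> y; rewrite expr2 {1 2}dotE mulr_suml mulr_suml; apply: eq_bigr => i _.
  rewrite mulr_sumr mulr_suml; apply: eq_bigr => j _; rewrite -!/(co x _); ring.
rewrite I_sum; last by move=> i; exact: bmf_sum.
rewrite mulr_suml; apply: eq_bigr => i _; rewrite I_sum// mulr_suml.
by apply: eq_bigr => j _; rewrite IZ// mulrA.
Qed.

Let bmf_beta : bmf beta. Proof. exact: bmf_ratio2. Qed.

(** Split off the last unit of time, over which the kernel multiplies <u,.> by [alpha]. *)
Lemma alpha_step k x u : inner u (sphere_val x) * ratio1 (r k.+1 x) =
  mean (r k x) x (fun y => alpha y * dot u y).
Proof.
rewrite -(mean_dot hsigma (r k.+1 x) x u) -{1}(addn0 k) (r_CK k 0 x (bmf_dot u)).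
congr vmf_mean; apply/funext => y.
by rewrite (mean_dot hsigma (r 0 y) y u) mulrC.
Qed.

Lemma beta_step k x u v : inner u v = 0 ->
  inner u (sphere_val x) * inner v (sphere_val x) * ratio2 (r k.+1 x) =
  mean (r k x) x (fun y => beta y * (dot u y * dot v y)).
Proof.
move=> uv; have bu := bmfM (bmf_dot u) (bmf_dot v).
rewrite -(mean_dot2 hsigma hd (r k.+1 x) x uv) -{1}(addn0 k) (r_CK k 0 x bu).
congr vmf_mean; apply/funext => y.
by rewrite (mean_dot2 hsigma hd (r 0 y) y uv) mulrC.
Qed.

(** The concentrations [r k x] are positive zeros of the exponential integral of [g], and they tend
    to 0 by [param_cvg0], so [moments_eq0] applies. *)
Lemma moments_vanish (x : S) g : bmf g ->
  (forall k, mean (r k x) x g = 0) ->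
  forall i, I (fun y => g y * dot (sphere_val x) y ^+ i) = 0.
Proof.
move=> bg g0; have [_ [M gM]] := bg.
apply: (moments_eq0 bg gM (bmf_dot _)) => [|e e0]; first by move=> y; exact: dot_le1.
have /cvgrPdist_le/(_ _ e0)[k _ /(_ k (leqnn k))] :=
  param_cvg0 hsigma hd r_gt0 r_bmf r_CK x.
rewrite /= sub0r normrN ger0_norm// => rk; exists (r k x); first by rewrite r_gt0.
have /eqP := g0 k; rewrite /vmf_mean mulf_eq0 invr_eq0.
by rewrite (gt_eqF (Z_gt0 hsigma (r_ge0 k x))) orbF => /eqP.
Qed.

Lemma unit_decomposition (v : 'rV[R]_d.+1) : v != 0 ->
  exists (x : S) (c : R), v = c *: sphere_val x.
Proof.
move=> v0; have n0 : 0 < inner v v.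
  by rewrite lt_neqAle inner_ge0 eq_sym inner_eq0 v0.
have s0 : Num.sqrt (inner v v) != 0 by rewrite gt_eqF// sqrtr_gt0.
have h : inner ((Num.sqrt (inner v v))^-1 *: v) ((Num.sqrt (inner v v))^-1 *: v) = 1.
  rewrite innerZl innerZr mulrA -invfM -expr2 sqr_sqrtr ?inner_ge0//.
  by rewrite mulVf// gt_eqF.
exists (mks h), (Num.sqrt (inner v v)); rewrite mksE scalerA divff//.
by rewrite scale1r.
Qed.

(** Write v as a multiple of a unit vector x. For u orthogonal to x, [alpha_step] says that alpha(y)
    <u,y> has mean 0 at all times 1, 2, ... from x, so all its moments in <x,y> vanish. *)
Lemma radial_alpha : radial sigma alpha.
Proof.
move=> u v k uv; have [->|v0] := eqVneq v 0.
  rewrite (@eq_I _ _ _ _ _ (fun=> 0)) ?I_cst// => y.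
  by rewrite /dot inner0l exprS mul0r mulr0.
have [x [c vx]] := unit_decomposition v0.
have c0 : c != 0 by apply: contraNneq v0 => c0; rewrite vx c0 scale0r.
have ux : inner u (sphere_val x) = 0.
  by move/eqP: uv; rewrite vx innerZr mulf_eq0 (negbTE c0) => /eqP.
rewrite (@eq_I _ _ _ _ _ (fun y => c ^+ k.+1 *
   (alpha y * dot u y * dot (sphere_val x) y ^+ k.+1))); last first.
  by move=> y; rewrite vx dotZ exprMn; ring.
have bu := bmf_dot u; have bx := bmf_dot (sphere_val x).
rewrite IZ; last by solve_bmf.
rewrite moments_vanish ?mulr0//; first by solve_bmf.
by move=> j; rewrite -alpha_step ux mul0r.
Qed.

(** The same with beta(y) <u,y> <x,y>; the factor <x,y> is taken from the power [k.+1] in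
    [radial]. *)
Lemma radial_beta : radial sigma beta.
Proof.
move=> u v k uv; have [->|v0] := eqVneq v 0.
  rewrite (@eq_I _ _ _ _ _ (fun=> 0)) ?I_cst// => y.
  by rewrite /dot inner0l exprS mul0r mulr0.
have [x [c vx]] := unit_decomposition v0.
have c0 : c != 0 by apply: contraNneq v0 => c0; rewrite vx c0 scale0r.
have ux : inner u (sphere_val x) = 0.
  by move/eqP: uv; rewrite vx innerZr mulf_eq0 (negbTE c0) => /eqP.
rewrite (@eq_I _ _ _ _ _ (fun y => c ^+ k.+1 *
   (beta y * (dot u y * dot (sphere_val x) y) * dot (sphere_val x) y ^+ k))).
  have bu := bmf_dot u; have bx := bmf_dot (sphere_val x).
  rewrite IZ; last by solve_bmf.
  rewrite moments_vanish ?mulr0//; first by solve_bmf.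
  by move=> j; rewrite -beta_step// ux !mul0r.
by move=> y; rewrite vx dotZ exprMn exprS [dot _ y ^+ k.+1]exprS; ring.
Qed.

Lemma radial_sub g c : bmf g -> radial sigma g -> radial sigma (fun y => g y - c).
Proof.
move=> bg rg u v k uv.
have r1 := radial1 hsigma k uv; have rgk := rg u v k uv.
have bu := bmf_dot u; have bv := bmf_dot v.
rewrite (@eq_I _ _ _ _ _ (fun y => g y * dot u y * dot v y ^+ k.+1 -
    c * (1 * dot u y * dot v y ^+ k.+1))); last by move=> y; ring.
by rewrite IB ?IZ ?rgk ?r1 ?mulr0 ?subr0//; solve_bmf.
Qed.

Lemma I_sub0 g : bmf g -> I (fun y => g y - I g) = 0.
Proof. by move=> bg; rewrite IB//; [rewrite I_cst subrr | exact: bmf_cst]. Qed.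

Let e_ i : 'rV[R]_d.+1 := delta_mx ord0 i.
Let e0_unit : inner (e_ ord0) (e_ ord0) = 1. Proof. by rewrite inner_deltas eqxx. Qed.
Let e0 : S := mks e0_unit.

(** [alpha - I alpha] is radial of mean 0, so by [radial_exp] the multiplier in [alpha_step] may be
    replaced by its mean. *)
Lemma ratio1_step k : ratio1 (r k.+1 e0) = I alpha * ratio1 (r k e0).
Proof.
have := alpha_step k e0 (e_ ord0); rewrite mksE e0_unit mul1r => ->.
rewrite /vmf_mean /ratio1 mulrA; congr (_ / _).
have := @radial_exp _ _ _ hd _ (bmfB bmf_alpha (bmf_cst (I alpha)))
  (radial_sub (I alpha) bmf_alpha radial_alpha) 1 (r k e0) (I_sub0 bmf_alpha).
have b1 : bmf (fun y : S => co y ord0 ^+ 1 * expR (r k e0 * co y ord0)) by solve_bmf.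
rewrite (@eq_I _ _ _ _ _ (fun y => alpha y *
    (co y ord0 ^+ 1 * expR (r k e0 * co y ord0)) -
    I alpha * (co y ord0 ^+ 1 * expR (r k e0 * co y ord0)))); last first.
  by move=> y; ring.
rewrite IB; [|exact: bmfM|by apply: (@bmfM _ _ _ (fun=> I alpha)) => //; exact: bmf_cst].
move=> /eqP; rewrite subr_eq0 IZ// => /eqP <-.
by apply: eq_I => y; rewrite mksE !dot_delta expr1 mulrA.
Qed.

Let j1 : 'I_d.+1 := inord 1.
Let j10 : j1 != ord0. Proof. by rewrite -val_eqE/= inordK. Qed.

Lemma ratio2_step k : ratio2 (r k.+1 e0) = I beta * ratio2 (r k e0).
Proof.
(* The forms y_0 + y_1 and y_0 - y_1 are orthogonal and both equal 1 at [e0], so [beta_step]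
   isolates [ratio2]. Their product y_0^2 - y_1^2 is within reach of [radial_exp] and
   [radial_exp2]. *)
have uv : inner (e_ ord0 + e_ j1) (e_ ord0 - e_ j1) = 0.
  rewrite !(innerDl, innerBr) !inner_deltas !eqxx eq_sym (negbTE j10).
  by rewrite subr0 sub0r subrr.
have ue : inner (e_ ord0 + e_ j1) (sphere_val e0) = 1.
  by rewrite mksE innerDl !inner_deltas eqxx (negbTE j10) addr0.
have ve : inner (e_ ord0 - e_ j1) (sphere_val e0) = 1.
  by rewrite mksE innerBl !inner_deltas eqxx (negbTE j10) subr0.
have := beta_step k e0 uv; rewrite ue ve !mul1r => ->.
have := mean_dot2 hsigma hd (r k e0) e0 uv; rewrite ue ve !mul1r => <-.
rewrite /vmf_mean mulrA; congr (_ / _).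
have bB := bmfB bmf_beta (bmf_cst (I beta)).
have rB := radial_sub (I beta) bmf_beta radial_beta.
have h1 := @radial_exp _ _ _ hd _ bB rB 2 (r k e0) (I_sub0 bmf_beta).
have h2 := @radial_exp2 _ _ _ hd _ bB rB j1 (r k e0) (I_sub0 bmf_beta) j10.
have bE : bmf (fun y : S => expR (r k e0 * co y ord0)) by solve_bmf.
have b1 : bmf (fun y : S => co y ord0 ^+ 2 * expR (r k e0 * co y ord0)) by solve_bmf.
have b2 : bmf (fun y : S => co y j1 ^+ 2 * expR (r k e0 * co y ord0)) by solve_bmf.
have b3 := bmfB b1 b2.
have H : I (fun y => (beta y - I beta) *
    (co y ord0 ^+ 2 * expR (r k e0 * co y ord0) -
     co y j1 ^+ 2 * expR (r k e0 * co y ord0))) = 0.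
  rewrite (@eq_I _ _ _ _ _ (fun y => (beta y - I beta) * co y ord0 ^+ 2 *
      expR (r k e0 * co y ord0) - (beta y - I beta) * co y j1 ^+ 2 *
      expR (r k e0 * co y ord0))); last by move=> y; ring.
  rewrite IB ?h1 ?h2 ?subrr//; rewrite -[bmf _]/(bmf (fun y => _)).
    by apply: bmfM => //; apply: bmfM => //; apply: bmfX; exact: bmf_co.
  by apply: bmfM => //; apply: bmfM => //; apply: bmfX; exact: bmf_co.
have E y : dot (e_ ord0 + e_ j1) y * dot (e_ ord0 - e_ j1) y *
    expR (r k e0 * dot (sphere_val e0) y) =
    co y ord0 ^+ 2 * expR (r k e0 * co y ord0) -
    co y j1 ^+ 2 * expR (r k e0 * co y ord0).
  by rewrite mksE dotD dotB !dot_delta; ring.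
rewrite (eq_I _ E) -IZ//.
rewrite [LHS](@eq_I _ _ _ _ _ (fun y => beta y *
    (co y ord0 ^+ 2 * expR (r k e0 * co y ord0) -
     co y j1 ^+ 2 * expR (r k e0 * co y ord0)))); last first.
  by move=> y; rewrite -E; ring.
apply/eqP; rewrite -subr_eq0 -IB; first last.
- by apply: (@bmfM _ _ _ (fun=> I beta)) => //; exact: bmf_cst.
- exact: bmfM.
by rewrite -H; apply/eqP; apply: eq_I => y; ring.
Qed.

Lemma vmf_semigroup_false : False.
Proof.
(* A zero mean of [alpha] would make the resultant length vanish at time 2, against [ratio1_gt0]. *)
have A0 : I alpha != 0.
  have := ratio1_gt0 hsigma hd (r_gt0 1 e0); rewrite ratio1_step.
  by apply: contraTneq => ->; rewrite mul0r ltxx.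
apply: (@ratios_not_geometric _ _ _ hsigma hd (r ^~ e0) (r_gt0 ^~ e0)
  (param_cvg0 hsigma hd r_gt0 r_bmf r_CK e0) (I beta / I alpha ^+ 2)) => k.
rewrite ratio1_step ratio2_step; field.
by rewrite A0 gt_eqF// ratio1_gt0.
Qed.

End NoSemigroup.

(** * Restriction of the process to integer times *)

Theorem theorem16 (R : realType) (d : nat) (hd : (1 <= d)%N)
    (sigma : probability (sphere R d) R) (hsigma : is_uniform sigma) :
  ~ exists (dO : measure_display) (Omega : measurableType dO)
      (X : homogeneous_markov_process R Omega (sphere R d)),
      forall (eta : sphere R d) (t : R), 0 < t ->
        exists2 rho : R, 0 < rho &
          forall A : set (sphere R d), measurable A ->
            transition X t eta A = MF sigma eta rho A.
Proof.
move=> [dO [W [X HX]]].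
have k0 (k : nat) : 0 < k.+1%:R :> R by rewrite ltr0n.
(* A concentration is chosen for each start at each of the times 1, 2, ...; measurability in [x]
   enters through the kernel, by [pmean_bmf]. *)
have H k x := cid2 (pmean_mean hsigma HX x (k0 k)).
pose r k x := s2val (H k x).
have r_gt0 k x : 0 < r k x := s2valP (H k x).
have rE k x f : bmf f -> vmf_mean sigma (r k x) x f = pmean X k.+1%:R x f.
  by move=> bf; rewrite (s2valP' (H k x) f bf).
have r_bmf k f : bmf f -> bmf (fun x => vmf_mean sigma (r k x) x f).
  by move=> bf; under eq_fun do rewrite rE//; exact: pmean_bmf.
apply: (vmf_semigroup_false hsigma hd r_gt0 r_bmf) => j k x f bf.
rewrite !rE//; last exact: r_bmf.
have -> : (j + k).+2%:R = j.+1%:R + k.+1%:R :> R by rewrite -natrD addnS addSn.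
rewrite pmean_CK//.
by congr pmean; apply/funext => y; rewrite rE.
Qed.
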